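(* Let $A(\Gamma)$ be a path RAAG. Let $\lbrace p_1,\dots,p_m\rbrace\subseteq A(\Gamma)$ be a set of pearls with the following properties. The triples $(x,y,z)=(p_1,p_2,p_3)$ and $(x,y,z)=(p_m,p_{m-1},p_{m-2})$ both satisfy condition (E), where $p_1$ and $p_m$ are the end pearls. For any $i\in\lbrace 3,\dots,m-2\rbrace$ the inner pearls $p_{i-1},p_i,p_{i+1}$ satisfy condition (T) with middle element $p_i$. Then $\lbrace p_1,\dots,p_m\rbrace$ is a vertex basis of $A(\Gamma)$.
   Context: All graphs are finite, undirected and simple. The right-angled Artin group (RAAG) with underlying graph $\Gamma$ is $A(\Gamma)=\langle v\in V(\Gamma)\mid [v,w]=1\text{ whenever }\{v,w\}\in E(\Gamma)\rangle$. A path RAAG is a RAAG whose underlying graph is a path with more than one vertex. $C(x)$ is the centralizer of $x$, $\langle\langle x\rangle\rangle$ the normal closure, $d(G)$ the minimal number of generators. A vertex basis of $A(\Gamma)$ is a generating set as in the presentation $\langle v\in V(\Gamma)\mid [v,w]=1\text{ whenever }\{v,w\}\in E(\Gamma)\rangle$, i.e. the image of the standard generators under an automorphism of $A(\Gamma)$. An inner pearl is a nontrivial element with non-abelian centralizer that generates the center of its centralizer. Inner pearls $x,y$ are adjacent if $[x,y]=1$ and there is $z\in A(\Gamma)$ with $[x,z]=1$ and $[y,z]\neq 1$. Condition (E) on $(x,y,z)$: $y,z$ are adjacent inner pearls, $C(y)=\langle x,y,z\rangle$, and $A(\Gamma)/\langle\langle y\rangle\rangle$ splits as a free product with one factor isomorphic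 to $\mathbb{Z}$; then $x$ is called an end pearl. Condition (T) on $y,x,z$ with middle element $x$: $d(A(\Gamma))\ge 5$, $x,y,z$ are inner pearls, $y,z\in C(x)$, and $y\langle x\rangle,z\langle x\rangle$ generate $C(x)/\langle x\rangle$. The pearls here are the elements that are inner pearls or end pearls in these senses. *)

(* Defs.v *)
From HB Require Import structures.
From mathcomp Require Import all_boot all_order all_algebra.
From mathcomp Require Import boolp classical_sets.

Set Implicit Arguments.
Unset Strict Implicit.
Unset Printing Implicit Defensive.

Local Open Scope classical_set_scope.
Local Open Scope group_scope.
Local Open Scope quotient_scope.

(* Groups are MathComp's possibly infinite [groupType]s; subsets are
   [classical_sets]. *)

Section Subgroups.
Variable G : groupType.
Implicit Types (A : set G) (x y : G).

Definition is_subgroup A :=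
  [/\ A 1, forall x y, A x -> A y -> A (x * y) & forall x, A x -> A x^-1].

Definition is_normal A :=
  is_subgroup A /\ forall x y, A x -> A (x ^ y).

Structure subgroup := Subgroup {
  subgroup_set :> set G;
  subgroupP : is_subgroup subgroup_set }.

Structure normal_subgroup := NormalSubgroup {
  normal_set :> set G;
  normalP : is_normal normal_set }.

Definition gen A : set G := smallest is_subgroup A.

Definition ncl A : set G := smallest is_normal A.

Definition generates A := gen A = setT.

Definition centralizer x : set G := [set y | commute x y].

Definition center A : set G := [set x | A x /\ forall y, A y -> commute x y].

Definition is_abelian A := forall x y, A x -> A y -> commute x y.

Lemma gen_subgroup A : is_subgroup (gen A).
Proof.
split; first by move=> H [[H1 _ _] _].
- move=> x y gx gy H [sH AH]; have [_ HM _] := sH.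
  by apply: HM; [apply: gx | apply: gy].
- by move=> x gx H [sH AH]; have [_ _ HV] := sH; apply: HV; apply: gx.
Qed.

Lemma ncl_normal A : is_normal (ncl A).
Proof.
split; first split; first by move=> H [[[H1 _ _] _] _].
- move=> x y gx gy H [sH AH]; have [[_ HM _] _] := sH.
  by apply: HM; [apply: gx | apply: gy].
- by move=> x gx H [sH AH]; have [[_ _ HV] _] := sH; apply: HV; apply: gx.
- by move=> x y gx H [sH AH]; have [_ HJ] := sH; apply: HJ; apply: gx.
Qed.

Lemma centralizer_subgroup x : is_subgroup (centralizer x).
Proof.
rewrite /centralizer; split=> [|y z cy cz|y cy] /=.
- exact: commute1.
- exact: commuteM.
- exact: commuteV.
Qed.

Lemma gen1_commute x y z : commute x y -> gen [set x] z -> commute z y.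
Proof.
move=> cxy /(_ (centralizer y)) gz; apply/esym/gz; split.
  exact: centralizer_subgroup.
by move=> _ ->; apply/esym.
Qed.

Canonical gen_subgroup_of A := Subgroup (gen_subgroup A).
Canonical ncl_normal_of A := NormalSubgroup (ncl_normal A).
Canonical centralizer_of x := Subgroup (centralizer_subgroup x).

End Subgroups.

Arguments generates : clear implicits.

(* A subgroup as a group in its own right. *)
Section SubgroupType.
Variables (G : groupType) (H : subgroup G).

Definition subgroup_pred : pred G := fun x => x \in (H : set G).

Record subg := Subg { subg_val : G; _ : subgroup_pred subg_val }.

HB.instance Definition _ := [isSub for subg_val].
HB.instance Definition _ := [Choice of subg by <:].

Lemma subgroup_closed : group_closed subgroup_pred.
Proof.
case: (subgroupP H) => H1 HM HV; split; first exact/mem_set.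
move=> x y /set_mem Hx /set_mem Hy; apply/mem_set.
exact: HM _ _ Hx (HV _ Hy).
Qed.

HB.instance Definition _ :=
  SubChoice_isSubGroup.Build G subgroup_pred subg subgroup_closed.

End SubgroupType.

Section QuotientGroup.
Variables (G : groupType) (N : normal_subgroup G).

Definition quot_rel : rel G := fun x y => `[< (N : set G) (x^-1 * y) >].

Lemma quot_rel_equiv : equiv_class_of quot_rel.
Proof.
have [[N1 NM NV] _] := normalP N; split.
- by move=> x; apply/asboolP; rewrite mulVg.
- move=> x y; apply/asbool_equiv_eq; split=> /NV; by rewrite invgM invgK.
- move=> y x z /asboolP xy /asboolP yz; apply/asboolP.
  by have := NM _ _ xy yz; rewrite mulgA mulgK.
Qed.

Canonical quot_equiv := EquivRelPack quot_rel_equiv.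

Definition quot := {eq_quot quot_rel}.

HB.instance Definition _ := Choice.on quot.

Definition to_quot (x : G) : quot := \pi_quot x.

Lemma to_quotP x y : to_quot x = to_quot y <-> (N : set G) (x^-1 * y).
Proof.
split=> [/eqmodP/asboolP //|Nxy]; exact/eqmodP/asboolP.
Qed.

Lemma repr_quotK u : to_quot (repr u) = u.
Proof. exact: reprK. Qed.

Definition quot_mul (u v : quot) := to_quot (repr u * repr v).
Definition quot_inv (u : quot) := to_quot (repr u)^-1.

Lemma to_quotM x y : to_quot (x * y) = quot_mul (to_quot x) (to_quot y).
Proof.
have [[N1 NM NV] NJ] := normalP N.
apply/to_quotP.
have /to_quotP hx := esym (repr_quotK (to_quot x)).
have /to_quotP hy := esym (repr_quotK (to_quot y)).
set x' := repr _ in hx *; set y' := repr _ in hy *.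
have -> : (x * y)^-1 * (x' * y') = (x^-1 * x') ^ y * (y^-1 * y').
  by rewrite /conjg invgM !mulgA mulgK.
exact: NM (NJ _ _ hx) hy.
Qed.

Lemma to_quotV x : to_quot x^-1 = quot_inv (to_quot x).
Proof.
have [[N1 NM NV] NJ] := normalP N.
apply/to_quotP.
have /to_quotP hx := esym (repr_quotK (to_quot x)).
set x' := repr _ in hx *.
have -> : x^-1^-1 * x'^-1 = ((x^-1 * x')^-1) ^ x^-1.
  by rewrite /conjg invgM !invgK !mulgA mulgK.
exact: NJ _ _ (NV _ hx).
Qed.

Fact quot_mulA : associative quot_mul.
Proof.
move=> u v w; rewrite -(repr_quotK u) -(repr_quotK v) -(repr_quotK w).
by rewrite -!to_quotM mulgA.
Qed.

Fact quot_mul1 : left_id (to_quot 1) quot_mul.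
Proof. by move=> u; rewrite -(repr_quotK u) -to_quotM mul1g. Qed.

Fact quot_1mul : right_id (to_quot 1) quot_mul.
Proof. by move=> u; rewrite -(repr_quotK u) -to_quotM mulg1. Qed.

Fact quot_mulV : left_inverse (to_quot 1) quot_inv quot_mul.
Proof. by move=> u; rewrite -(repr_quotK u) -to_quotV -to_quotM mulVg. Qed.

Fact quot_Vmul : right_inverse (to_quot 1) quot_inv quot_mul.
Proof. by move=> u; rewrite -(repr_quotK u) -to_quotV -to_quotM mulgV. Qed.

HB.instance Definition _ := isGroup.Build quot
  quot_mulA quot_mul1 quot_1mul quot_mulV quot_Vmul.

End QuotientGroup.

Section FreeGroup.
Variable X : choiceType.

(* The letter [(x, false)] stands for x and [(x, true)] for its inverse. *)
Notation word := (seq (X * bool)).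

Inductive word_eq : word -> word -> Prop :=
| word_eq_refl w : word_eq w w
| word_eq_sym v w : word_eq v w -> word_eq w v
| word_eq_trans u v w : word_eq u v -> word_eq v w -> word_eq u w
| word_eq_cancel u x b v :
    word_eq (u ++ [:: (x, b); (x, ~~ b)] ++ v) (u ++ v).

Definition word_rel : rel word := fun u v => `[< word_eq u v >].

Lemma word_rel_equiv : equiv_class_of word_rel.
Proof.
split.
- by move=> w; apply/asboolP; apply: word_eq_refl.
- by move=> v w; apply/asbool_equiv_eq; split; apply: word_eq_sym.
- move=> v u w /asboolP uv /asboolP vw; apply/asboolP.
  exact: word_eq_trans uv vw.
Qed.

Canonical word_equiv := EquivRelPack word_rel_equiv.

Definition free_group := {eq_quot word_rel}.

HB.instance Definition _ := Choice.on free_group.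

Definition of_word (w : word) : free_group := \pi_free_group w.

Definition fgen (x : X) : free_group := of_word [:: (x, false)].

Definition word_inv (w : word) : word := rev [seq (a.1, ~~ a.2) | a <- w].

Lemma of_wordP u v : of_word u = of_word v <-> word_eq u v.
Proof. by split=> [/eqmodP/asboolP //|uv]; exact/eqmodP/asboolP. Qed.

Lemma repr_wordK u : of_word (repr u) = u.
Proof. exact: reprK. Qed.

Definition free_mul (u v : free_group) := of_word (repr u ++ repr v).
Definition free_inv (u : free_group) := of_word (word_inv (repr u)).

Lemma word_eq_cat2 u u' v v' :
  word_eq u u' -> word_eq v v' -> word_eq (u ++ v) (u' ++ v').
Proof.
move=> uu' vv'; apply: (@word_eq_trans _ (u' ++ v)).
  elim: uu' => [w|w1 w2 _|w1 w2 w3 _ h1 _ h2|w1 x b w2].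
  - exact: word_eq_refl.
  - exact: word_eq_sym.
  - exact: word_eq_trans h1 h2.
  - by rewrite -!catA; apply: word_eq_cancel.
elim: vv' => [w|w1 w2 _|w1 w2 w3 _ h1 _ h2|w1 x b w2].
- exact: word_eq_refl.
- exact: word_eq_sym.
- exact: word_eq_trans h1 h2.
- by rewrite !(catA u'); apply: word_eq_cancel.
Qed.

Lemma word_inv_catV w : word_eq (word_inv w ++ w) [::].
Proof.
elim: w => [|[x b] w IHw]; first exact: word_eq_refl.
rewrite /word_inv /= rev_cons cat_rcons.
apply: word_eq_trans IHw.
have := word_eq_cancel (word_inv w) x (~~ b) w.
by rewrite negbK.
Qed.

Lemma word_cat_invV w : word_eq (w ++ word_inv w) [::].
Proof.
suff {1}<- : word_inv (word_inv w) = w by apply: word_inv_catV.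
rewrite /word_inv map_rev revK -map_comp -[RHS]map_id.
by apply: eq_map => -[x b] /=; rewrite negbK.
Qed.

Lemma of_word_cat u v : of_word (u ++ v) = free_mul (of_word u) (of_word v).
Proof.
by apply/of_wordP/word_eq_cat2; apply/of_wordP; rewrite repr_wordK.
Qed.

Fact free_mulA : associative free_mul.
Proof.
move=> u v w; rewrite -(repr_wordK u) -(repr_wordK v) -(repr_wordK w).
by rewrite -!of_word_cat catA.
Qed.

Fact free_mul1 : left_id (of_word [::]) free_mul.
Proof. by move=> u; rewrite -(repr_wordK u) -of_word_cat. Qed.

Fact free_1mul : right_id (of_word [::]) free_mul.
Proof. by move=> u; rewrite -(repr_wordK u) -of_word_cat cats0. Qed.

Fact free_mulV : left_inverse (of_word [::]) free_inv free_mul.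
Proof.
move=> u; rewrite -{2}(repr_wordK u) /free_inv -of_word_cat.
exact/of_wordP/word_inv_catV.
Qed.

Fact free_Vmul : right_inverse (of_word [::]) free_inv free_mul.
Proof.
move=> u; rewrite -{1}(repr_wordK u) /free_inv -of_word_cat.
exact/of_wordP/word_cat_invV.
Qed.

HB.instance Definition _ := isGroup.Build free_group
  free_mulA free_mul1 free_1mul free_mulV free_Vmul.

End FreeGroup.

(* The group presented by generators X and relators R. *)
Definition presented (X : choiceType) (R : set (free_group X)) : groupType :=
  quot (ncl_normal_of R).

Definition pgen (X : choiceType) (R : set (free_group X)) (x : X) :
  presented R := to_quot _ (fgen x).

Definition isomorphic (G H : groupType) :=
  exists f : {multiplicative G -> H}, bijective f.

Definition infinite_cyclic (G : groupType) :=
  exists f : int -> G,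
    bijective f /\ forall a b : int, f (a + b)%R = f a * f b.

(* H * K, presented by the disjoint union of H and K with both
   multiplication tables as relators. *)
Definition free_product_relators (H K : groupType) :
    set (free_group (H + K)%type) :=
  [set fgen (inl hh.1) * fgen (inl hh.2) * (fgen (inl (hh.1 * hh.2)))^-1
    | hh in [set: H * H]] `|`
  [set fgen (inr kk.1) * fgen (inr kk.2) * (fgen (inr (kk.1 * kk.2)))^-1
    | kk in [set: K * K]].

Definition free_product (H K : groupType) : groupType :=
  presented (@free_product_relators H K).

(* As usual for splittings, the complementary factor is nontrivial. *)
Definition splits_off_Z (G : groupType) :=
  exists H K : groupType,
    [/\ infinite_cyclic H, exists k : K, k <> 1
      & isomorphic G (free_product H K)].

(* d(G); junk value 0 when G is not finitely generated. *)
Definition min_generators (G : groupType) : nat :=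
  xget 0%N [set n : nat |
    (exists s : seq G, size s = n /\ generates G [set` s]) /\
    (forall s : seq G, generates G [set` s] -> (n <= size s)%N)].

Structure sgraph := SGraph {
  vertex :> finType;
  edge : rel vertex;
  edge_sym : symmetric edge;
  edge_irr : irreflexive edge }.

Definition is_path_graph (Gamma : sgraph) :=
  exists f : 'I_#|Gamma| -> Gamma, bijective f /\
    forall i j : 'I_#|Gamma|,
      edge (f i) (f j) = ((i.+1 == j :> nat) || (j.+1 == i :> nat)).

Definition raag_relators (Gamma : sgraph) : set (free_group Gamma) :=
  [set r | exists v w : Gamma, edge v w /\ r = [~ fgen v, fgen w]].

Definition raag (Gamma : sgraph) : groupType := presented (@raag_relators Gamma).

Definition raag_gen (Gamma : sgraph) (v : Gamma) : raag Gamma := pgen _ v.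

Definition vertex_basis (Gamma : sgraph) (B : set (raag Gamma)) :=
  exists phi : {multiplicative raag Gamma -> raag Gamma},
    bijective phi /\ B = phi @` range (@raag_gen Gamma).

Section Pearls.
Variable G : groupType.
Implicit Types x y z : G.

Definition inner_pearl x :=
  [/\ x <> 1, ~ is_abelian (centralizer x)
    & gen [set x] = center (centralizer x)].

Definition adjacent x y :=
  [/\ inner_pearl x, inner_pearl y, [~ x, y] = 1
    & exists z, [~ x, z] = 1 /\ [~ y, z] <> 1].

Definition condE x y z :=
  [/\ adjacent y z, centralizer y = gen [set x; y; z]
    & splits_off_Z (quot (ncl_normal_of [set y]))].

Definition end_pearl x := exists y z, condE x y z.

Definition pearl x := inner_pearl x \/ end_pearl x.

(* The cyclic subgroup generated by x, inside the group C(x). *)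
Definition cycle_in_centralizer x : set (subg (centralizer_of x)) :=
  [set u | gen [set x] (val u)].

Arguments cycle_in_centralizer : clear implicits.

Lemma cycle_in_centralizer_normal x : is_normal (cycle_in_centralizer x).
Proof.
have [g1 gM gV] := gen_subgroup [set x].
split; first split=> //=.
- by move=> u v; rewrite /cycle_in_centralizer /= => gu gv; apply: gM.
- by move=> u; rewrite /cycle_in_centralizer /= => gu; apply: gV.
- move=> u v; rewrite /cycle_in_centralizer /= => gu.
  have cxv : commute x (val v) by have /set_mem := valP v.
  have cuv := gen1_commute cxv gu.
  suff E : u ^ v = u by rewrite -E in gu.
  rewrite /conjg; have -> : u * v = v * u by exact: val_inj.
  by rewrite mulKg.
Qed.

Definition centralizer_quot x : groupType :=
  quot (NormalSubgroup (cycle_in_centralizer_normal x)).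

(* The triple is written (y, x, z): the middle element is the second one. *)
Definition condT y x z :=
  [/\ (5 <= min_generators G)%N,
      [/\ inner_pearl x, inner_pearl y & inner_pearl z],
      centralizer x y, centralizer x z
    & generates (centralizer_quot x)
        [set to_quot _ u | u in
          [set u : subg (centralizer_of x) | val u = y \/ val u = z]]].

End Pearls.

(* Main.v *)
(* Number the vertices v_1, ..., v_n along the path.

   Inner pearls are the conjugates of v_i^(+-1) with 1 < i < n.  By induction on
   the length of the path, the centralizer of x is abelian unless x is
   conjugate to a power of a vertex: the last vertex gives an action on a tree
   with cyclic edge stabilizers; if x is hyperbolic, commutators in C(x) fix a
   ray of its axis, hence lie in an edge stabilizer, and being trivial in the
   abelianization they are trivial; if x is elliptic and fixes no edge, C(x)
   fixes the same vertex as x.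

   If A / <<y>> = Z * K, the class dual to Z has zero cup product with every
   class killing y.  A vertex in its support can only have the vertex of y as
   neighbour, so y is conjugate to v_2^(+-1) or v_{n-1}^(+-1).

   After an automorphism p_2 = v_2, and successively p_i = v_i for all inner
   pearls: p_{i+1} commutes with v_i and together with v_{i-1} it generates the
   free group C(v_i) / <v_i>, so p_{i+1} = a v_{i+1}^(+-1) b c with a, b powers of
   v_{i-1} and c a power of v_i; being conjugate to a vertex it is
   a v_{i+1}^(+-1) a^-1, and a partial conjugation moves it to v_{i+1}.  The other
   condition (E) forces m = n, and the two end pearls have the form
   a v_1^(+-1) b c and a v_n^(+-1) b c, reached by transvections. *)

(* Exponent sums, the homomorphisms to Z that count one vertex, are constant on conjugacy classes.
   They tell to which vertex an inner pearl is conjugate, and in a v_{i+1}^(+-1) b c they are what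
   gives c = 1 and ab = 1.

   The step from p_2 to p_3 cannot follow the pattern of the later ones: p_1 is not known to be a
   vertex when p_3 has to be placed, so no member of a basis of C(v_2) / <v_2> is at hand. The
   retraction onto the star of v_2 replaces it: p_3 is conjugate to a vertex of the star, up to
   sign, by an element of C(v_2), and conjugation by this element leaves v_2 alone. It does not
   exclude p_3 = v_2^(+-1); this is where the element z in the definition of adjacency enters.

   Nothing makes the end pearls conjugate to vertices, so their factors b and c stay arbitrary. The
   transvections absorbing them exist because an end vertex has a single neighbour, with which a, b
   and c commute. *)
From HB Require Import structures.
Require Import Defs.
From mathcomp Require Import all_boot all_order all_algebra.
From mathcomp Require Import boolp classical_sets.
From mathcomp Require Import ring zify.
Import GRing.Theory Num.Theory.

Set Implicit Arguments.
Unset Strict Implicit.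
Unset Printing Implicit Defensive.

Local Open Scope classical_set_scope.
Local Open Scope group_scope.

(* Unlike [invgM] and [invgK], these carry no reverse coercion in their
   instances, which would block rewriting in the concrete groups below. *)
Lemma groupVM (G : groupType) (x y : G) : (x * y)^-1 = y^-1 * x^-1.
Proof. exact: invgM. Qed.

Lemma groupVK (G : groupType) (x : G) : x^-1^-1 = x.
Proof. exact: invgK. Qed.

(** * Generated subgroups, morphisms and universal properties *)

Section Generation.
Variable G : groupType.
Implicit Types (A B : set G) (x y g : G).

Lemma gen_min A B x : is_subgroup B -> A `<=` B -> gen A x -> B x.
Proof. by move=> sB AB; apply. Qed.

Lemma sub_gen A : A `<=` gen A.
Proof. by move=> x Ax B [_]; apply. Qed.

Lemma gen1 A : gen A 1.
Proof. by case: (gen_subgroup A). Qed.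

Lemma genM A x y : gen A x -> gen A y -> gen A (x * y).
Proof. by case: (gen_subgroup A) => _ gM _; apply: gM. Qed.

Lemma genV A x : gen A x -> gen A x^-1.
Proof. by case: (gen_subgroup A) => _ _ gV; apply: gV. Qed.

Lemma genX A x n : gen A x -> gen A (x ^+ n).
Proof.
move=> gx; elim: n => [|n IHn]; first exact: gen1.
by rewrite expgS; apply: genM.
Qed.

Lemma gen_sub A B : A `<=` gen B -> gen A `<=` gen B.
Proof. by move=> AB x; apply: gen_min => //; apply: gen_subgroup. Qed.

Lemma gen_mono A B : A `<=` B -> gen A `<=` gen B.
Proof. by move=> AB; apply: gen_sub => x /AB; apply: sub_gen. Qed.

(** [P] itself need not define a subgroup. The elements [y] such that right multiplication by [y]
    and by its inverse preserves [P] do form one; this is [B]. *)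
Lemma gen_ind_r A (P : G -> Prop) : P 1 ->
    (forall x a, P x -> A a -> P (x * a)) ->
    (forall x a, P x -> A a -> P (x * a^-1)) ->
  forall x, gen A x -> P x.
Proof.
move=> P1 PM PV x gx; rewrite -(mul1g x).
pose B : set G := [set y | (forall z, P z -> P (z * y)) /\
                           (forall z, P z -> P (z * y^-1))].
suff /(_ x gx) [+ _] : gen A `<=` B by apply.
move=> y; apply: gen_min => [|a Aa]; last first.
  by split=> z Pz; [apply: PM | apply: PV].
split; first by split=> z; rewrite ?invg1 mulg1.
- move=> u v [u1 u2] [v1 v2]; split=> z Pz; first by rewrite mulgA; auto.
  by rewrite groupVM mulgA; auto.
- by move=> u [u1 u2]; split=> z Pz; rewrite ?groupVK; auto.
Qed.

Lemma gen1P c x :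
  gen [set c] x -> exists n : nat, x = c ^+ n \/ x = c ^- n.
Proof.
move=> gx; elim/gen_ind_r: x / gx => [|x _ [n nP] ->|x _ [n nP] ->].
- by exists 0%N; left.
- case: nP => ->; first by exists n.+1; left; rewrite expgSr.
  case: n => [|n]; first by exists 1%N; left; rewrite invg1 mul1g.
  by exists n; right; rewrite expgS groupVM mulgVK.
- case: nP => ->; last by exists n.+1; right; rewrite expgS groupVM.
  case: n => [|n]; first by exists 1%N; right; rewrite mul1g.
  by exists n; left; rewrite expgSr mulgK.
Qed.

Lemma commute_gen A x y : (forall a, A a -> commute x a) -> gen A y ->
  commute x y.
Proof.
by move=> xA; apply: (@gen_min _ (centralizer x)) => //; apply: centralizer_subgroup.
Qed.

Lemma subgroupM A x y : is_subgroup A -> A x -> A y -> A (x * y).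
Proof. by case=> _ AM _; apply: AM. Qed.

Lemma subgroupV A x : is_subgroup A -> A x -> A x^-1.
Proof. by case=> _ _ AV; apply: AV. Qed.

Lemma subgroupJ A x y : is_subgroup A -> A x -> A y -> A (x ^ y).
Proof.
move=> sA Ax Ay; apply: subgroupM => //; first exact: subgroupV.
exact: subgroupM.
Qed.

Lemma commuteJ x y g : commute x y -> commute (x ^ g) (y ^ g).
Proof. by move=> cxy; rewrite /commute -!conjMg cxy. Qed.

End Generation.

Section Morphisms.
Variables G H : groupType.

Section Rules.
Variable h : {multiplicative G -> H}.

Lemma mult1 : h 1 = 1.
Proof. by apply: (mulgI (h 1)); rewrite -gmulfM !mulg1. Qed.

Lemma multV : {morph h : x / x^-1}.
Proof. by move=> x; apply: (mulgI (h x)); rewrite -gmulfM !mulgV mult1. Qed.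

Lemma multX n : {morph h : x / x ^+ n}.
Proof.
by move=> x; elim: n => [|n IHn]; rewrite ?mult1 // !expgS gmulfM IHn.
Qed.

Lemma multJ : {morph h : x y / x ^ y}.
Proof. by move=> x y; rewrite /conjg !gmulfM multV. Qed.

Lemma multR : {morph h : x y / [~ x, y]}.
Proof. by move=> x y; rewrite /commg gmulfM multJ multV. Qed.

End Rules.

Lemma multiplicative_of (h : G -> H) : {morph h : x y / x * y} ->
  exists k : {multiplicative G -> H}, k =1 h.
Proof.
move=> hM; pose m := isMultiplicative.Build G H h hM.
pose k : {multiplicative G -> H} := HB.pack h m.
by exists k.
Qed.

Lemma preim_subgroup (h : {multiplicative G -> H}) (B : set H) :
  is_subgroup B -> is_subgroup (h @^-1` B).
Proof.
move=> [B1 BM BV]; split; rewrite /preimage /mkset.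
- by rewrite mult1.
- by move=> x y Bx By; rewrite gmulfM; apply: BM.
- by move=> x Bx; rewrite multV; apply: BV.
Qed.

Lemma equalizer_subgroup (h k : {multiplicative G -> H}) :
  is_subgroup [set x | h x = k x].
Proof.
split=> /=; first by rewrite !mult1.
- by move=> x y hx hy; rewrite !gmulfM hx hy.
- by move=> x hx; rewrite !multV hx.
Qed.

Lemma gen_morph (h : {multiplicative G -> H}) (A : set G) (B : set H) x :
  (forall a, A a -> gen B (h a)) -> gen A x -> gen B (h x).
Proof.
move=> AB; apply: (@gen_min _ _ (h @^-1` gen B)) => //.
exact/preim_subgroup/gen_subgroup.
Qed.

Lemma eq_on_gen (h k : {multiplicative G -> H}) (A : set G) x :
  (forall a, A a -> h a = k a) -> gen A x -> h x = k x.
Proof.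
by move=> hk; apply: (@gen_min _ _ [set x | h x = k x]) => //;
  apply: equalizer_subgroup.
Qed.

End Morphisms.

Lemma quot_lift (G H : groupType) (N : normal_subgroup G) (h : {multiplicative G -> H}) :
  (forall x, (N : set G) x -> h x = 1) ->
  exists k : {multiplicative quot N -> H}, forall x, k (to_quot N x) = h x.
Proof.
move=> hN; have hE x : h (repr (to_quot N x)) = h x.
  have /to_quotP/hN := repr_quotK (to_quot N x).
  rewrite gmulfM multV => /(congr1 ( *%g (h (repr (to_quot N x))))).
  by rewrite mulVKg mulg1 => ->.
have [k kE] : exists k : {multiplicative quot N -> H}, k =1 (fun u => h (repr u)).
  apply: multiplicative_of.
  move=> u v; rewrite -(repr_quotK u) -(repr_quotK v).
  have -> : to_quot N (repr u) * to_quot N (repr v) =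
            to_quot N (repr u * repr v) by rewrite to_quotM.
  by rewrite !hE gmulfM.
by exists k => x; rewrite kE.
Qed.

Lemma to_quot_morph (G : groupType) (N : normal_subgroup G) :
  {morph to_quot N : x y / x * y}.
Proof. exact: to_quotM. Qed.

Section FreeGroupLift.
Variable X : choiceType.
Local Notation word := (seq (X * bool)).

Section Eval.
Variables (H : groupType) (q : X -> H).

Definition letter_val (a : X * bool) : H := if a.2 then (q a.1)^-1 else q a.1.
Definition word_val (w : word) : H := foldr (fun a => *%g (letter_val a)) 1 w.

Lemma word_val_cat u v : word_val (u ++ v) = word_val u * word_val v.
Proof. by elim: u => [|a u IHu] /=; rewrite ?mul1g // IHu mulgA. Qed.

Lemma word_val_eq u v : word_eq u v -> word_val u = word_val v.
Proof.
elim=> // [u1 u2 u3 _ -> _ -> //|u1 x b v1].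
rewrite !word_val_cat /= mulg1 /letter_val.
by case: b; rewrite /= ?mulgV ?mulVg mul1g.
Qed.

Lemma free_lift :
  exists h : {multiplicative free_group X -> H}, forall w, h (of_word w) = word_val w.
Proof.
have E w : word_val (repr (of_word w)) = word_val w.
  by apply/word_val_eq/of_wordP; rewrite repr_wordK.
have [h hE] : exists h : {multiplicative free_group X -> H},
    h =1 (fun u => word_val (repr u)).
  apply: multiplicative_of.
  move=> u v; rewrite -(repr_wordK u) -(repr_wordK v).
  have -> : of_word (repr u) * of_word (repr v) = of_word (repr u ++ repr v).
    by rewrite of_word_cat.
  by rewrite !E word_val_cat.
by exists h => w; rewrite hE E.
Qed.

Lemma free_lift_gen :
  exists h : {multiplicative free_group X -> H}, forall x, h (fgen x) = q x.
Proof.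
by have [h hE] := free_lift; exists h => x; rewrite hE /= mulg1.
Qed.

End Eval.

Lemma of_wordE (w : word) : of_word w = word_val (@fgen X) w.
Proof.
elim: w => [|[x b] w IHw] //=; rewrite -cat1s of_word_cat IHw.
congr ( *%g ); case: b => //=; rewrite /letter_val /=.
apply: (mulgI (fgen x)); rewrite mulgV.
rewrite /fgen -[_ * _]/(free_mul _ _) -of_word_cat.
by apply/of_wordP/(word_eq_cancel [::] x false [::]).
Qed.

Lemma of_wordM (u v : word) : of_word (u ++ v) = of_word u * of_word v.
Proof. by rewrite of_word_cat. Qed.

Lemma free_gen : generates (free_group X) (range (@fgen X)).
Proof.
apply/seteqP; split=> // u _; rewrite -(repr_wordK u) of_wordE.
elim: (repr u) => [|[x b] w IHw] /=; first exact: gen1.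
apply: genM => //; rewrite /letter_val /=; case: b; last by apply: sub_gen; exists x.
by apply: genV; apply: sub_gen; exists x.
Qed.

End FreeGroupLift.

Section Presented.
Variables (X : choiceType) (R : set (free_group X)) (H : groupType).

Lemma presented_lift (q : X -> H)
    (h : {multiplicative free_group X -> H}) :
  (forall x, h (fgen x) = q x) -> (forall r, R r -> h r = 1) ->
  exists k : {multiplicative presented R -> H}, forall x, k (pgen R x) = q x.
Proof.
move=> hq hR; have hN x : ncl R x -> h x = 1.
  move=> /(_ [set y | h y = 1]); apply; split=> [|r /hR //].
  split; first split=> /=; first exact: mult1.
  - by move=> y z; rewrite gmulfM => -> ->; rewrite mulg1.
  - by move=> y; rewrite multV => ->; rewrite invg1.
  - by move=> y z /=; rewrite multJ => ->; rewrite conj1g.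
by have [k kE] := quot_lift hN; exists k => x; rewrite kE.
Qed.

Lemma presented_gen : generates (presented R) (range (pgen R)).
Proof.
apply/seteqP; split=> // u _; rewrite -(repr_quotK u).
have [k kE] := multiplicative_of (@to_quot_morph _ (ncl_normal_of R)).
rewrite -kE; have : gen (range (@fgen X)) (repr u) by rewrite free_gen.
apply: gen_morph => _ [x _ <-]; rewrite kE.
by apply: sub_gen; exists x.
Qed.

End Presented.

Section Raag.
Variable Gamma : sgraph.
Local Notation G := (raag Gamma).
Local Notation v_ := (@raag_gen Gamma).

Lemma raag_lift (H : groupType) (q : Gamma -> H) :
  (forall u w, edge u w -> commute (q u) (q w)) ->
  exists h : {multiplicative G -> H}, forall u, h (v_ u) = q u.
Proof.
move=> qE; have [h hq] := free_lift_gen q.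
apply: (presented_lift hq) => _ [u [w [uw ->]]].
rewrite multR !hq; exact/eqP/commgP/qE.
Qed.

Lemma raag_generated x : gen (range v_) x.
Proof. by rewrite presented_gen. Qed.

Lemma raag_ext (H : groupType) (h k : {multiplicative G -> H}) :
  (forall u, h (v_ u) = k (v_ u)) -> h =1 k.
Proof. by move=> hk x; apply: eq_on_gen (raag_generated x) => _ [u _ <-]. Qed.

Lemma raag_edge_commute u w : edge u w -> commute (v_ u) (v_ w).
Proof.
move=> uw; have [k kE] := multiplicative_of (@to_quot_morph _ (ncl_normal_of (@raag_relators Gamma))).
rewrite /raag_gen /pgen -!kE; apply/commgP/eqP; rewrite -multR kE.
have <- : to_quot (ncl_normal_of (@raag_relators Gamma)) 1 = 1 by [].
apply/to_quotP; rewrite mulg1; have [[_ _ NV] _] := ncl_normal (@raag_relators Gamma).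
by apply: NV => N [_]; apply; exists u, w.
Qed.

End Raag.

Lemma free_product_lift (H K L : groupType)
    (h : {multiplicative H -> L}) (k : {multiplicative K -> L}) :
  exists g : {multiplicative free_product H K -> L},
    (forall x, g (pgen _ (inl x)) = h x) /\ (forall y, g (pgen _ (inr y)) = k y).
Proof.
pose q (s : H + K) := match s with inl x => h x | inr y => k y end.
have [f fq] := free_lift_gen q.
have [|g gE] := @presented_lift _ (@free_product_relators H K) _ q f fq.
  move=> _ [] [[a b] _ <-] /=; rewrite !gmulfM multV !fq /= gmulfM; exact: mulgV.
by exists g; split=> ?; rewrite gE.
Qed.

(** * Free groups *)

Section NormalForm.
Variable X : choiceType.
Local Notation word := (seq (X * bool)).
Implicit Types (a b : X * bool) (u v w : word).

Definition linv a : X * bool := (a.1, ~~ a.2).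

Lemma linvK a : linv (linv a) = a.
Proof. by case: a => x b; rewrite /linv /= negbK. Qed.

Lemma linv_neq a : (linv a == a) = false.
Proof. by apply/eqP; case: a => x [] []. Qed.

Definition reduced w := sorted (fun a b => b != linv a) w.

Definition push a w :=
  if w is b :: w' then if b == linv a then w' else a :: w else [:: a].

Definition nf w : word := foldr push [::] w.

Lemma reduced_catl u v : reduced (u ++ v) -> reduced u.
Proof. by case: u => //= a u; rewrite cat_path => /andP[]. Qed.

Lemma reduced_catr u v : reduced (u ++ v) -> reduced v.
Proof.
case: u => //= a u; rewrite cat_path => /andP[_].
by case: v => //= b v /andP[].
Qed.

Lemma reduced_tail a w : reduced (a :: w) -> reduced w.
Proof. exact: (@reduced_catr [:: a]). Qed.

Lemma reduced_cat u v a0 : reduced u -> reduced v ->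
  u = [::] \/ v = [::] \/ head a0 v != linv (last a0 u) -> reduced (u ++ v).
Proof.
case: u => //= a u; rewrite cat_path => -> /=.
case: v => //= b v rv [//|[//|->]] /=; exact: rv.
Qed.

Lemma nseq_reduced a n : reduced (nseq n a).
Proof.
elim: n => // -[|n] // IHn; rewrite /reduced /= eq_sym linv_neq; exact: IHn.
Qed.

Lemma reduced_junction u v a0 : reduced (u ++ v) -> u != [::] -> v != [::] ->
  head a0 v != linv (last a0 u).
Proof. by case: u => //= a u; rewrite cat_path; case: v => //= b v /and3P[]. Qed.

Lemma push_reduced a w : reduced w -> reduced (push a w).
Proof.
case: w => //= b w rw; case: (eqVneq b (linv a)) => [_|ba].
  exact: reduced_tail rw.
by rewrite /reduced /= ba.
Qed.

Lemma nf_reduced w : reduced (nf w).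
Proof. by elim: w => //= a w; apply: push_reduced. Qed.

(** Van der Waerden's argument: [push a] and [push (linv a)] are mutually inverse on reduced words,
    so [nf] does not see a cancelling pair. *)
Lemma push_linv a w : reduced w -> push a (push (linv a) w) = w.
Proof.
case: w => [|b w] /=; first by rewrite eqxx.
rewrite linvK; case: (eqVneq b a) => [->|ba] rw /=; last by rewrite eqxx.
by case: w rw => //= c w /andP[/negbTE ->].
Qed.

Lemma nf_id w : reduced w -> nf w = w.
Proof.
elim: w => //= a w IHw rw; rewrite IHw ?(reduced_tail rw) //.
by case: w rw {IHw} => //= b w /andP[/negbTE ->].
Qed.

Lemma nf_eq u v : word_eq u v -> nf u = nf v.
Proof.
elim=> // [u1 u2 u3 _ -> _ -> //|w1 x b w2]; rewrite /nf !foldr_cat /=.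
by rewrite (_ : (x, ~~ b) = linv (x, b)) // push_linv // nf_reduced.
Qed.

Lemma of_word_linv a : of_word [:: linv a] = (of_word [:: a])^-1.
Proof.
apply: (mulgI (of_word [:: a])); rewrite mulgV -of_wordM.
case: a => x b; exact/of_wordP/(word_eq_cancel [::] x b [::]).
Qed.

Lemma of_word_cons a w : of_word (a :: w) = of_word [:: a] * of_word w.
Proof. by rewrite -of_wordM. Qed.

Lemma of_word_inv w : of_word (word_inv w) = (of_word w)^-1.
Proof.
elim: w => [|a w IHw]; first by rewrite invg1.
rewrite of_word_cons groupVM -IHw. rewrite -of_word_linv -of_wordM.
by rewrite /word_inv /= rev_cons -cats1.
Qed.

Lemma of_nf w : of_word (nf w) = of_word w.
Proof.
elim: w => //= a w IHw; rewrite of_word_cons -IHw -of_word_cons.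
case: (nf w) => //= b w'; case: eqVneq => // ->.
by rewrite (of_word_cons a) (of_word_cons (linv a)) of_word_linv mulVKg.
Qed.

Definition nform (g : free_group X) := nf (repr g).

Lemma nform_of_word w : nform (of_word w) = nf w.
Proof. by apply/nf_eq/of_wordP; rewrite repr_wordK. Qed.

Lemma of_nform g : of_word (nform g) = g.
Proof. by rewrite of_nf repr_wordK. Qed.

Lemma nform_reduced g : reduced (nform g).
Proof. exact: nf_reduced. Qed.

Lemma nform_reducedE w : reduced w -> nform (of_word w) = w.
Proof. by move=> rw; rewrite nform_of_word nf_id. Qed.

Lemma nform_inj : injective nform.
Proof. exact: can_inj of_nform. Qed.

Lemma nform1 : nform 1 = [::].
Proof. by rewrite -[1]/(of_word [::]) nform_of_word. Qed.

Lemma nform_eq0 g : nform g = [::] -> g = 1.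
Proof. by move=> g0; apply: nform_inj; rewrite nform1. Qed.

Lemma nf_letters w a : a \in nf w -> a \in w.
Proof.
elim: w a => //= b w IHw a; rewrite inE.
case E: (nf w) => [|c w'] /=; first by rewrite inE => ->.
case: ifP => _; last by rewrite inE => /orP[->//|]; rewrite -E => /IHw ->; rewrite orbT.
by move=> aw'; rewrite IHw ?orbT // E inE aw' orbT.
Qed.

Lemma word_invK : involutive (@word_inv X).
Proof.
move=> w; rewrite /word_inv map_rev revK -map_comp -[RHS]map_id.
by apply: eq_map => -[x b] /=; rewrite negbK.
Qed.

Lemma word_inv_cons a w : word_inv (a :: w) = rcons (word_inv w) (linv a).
Proof. by rewrite /word_inv /= rev_cons. Qed.

Lemma word_inv_rcons a w : word_inv (rcons w a) = linv a :: word_inv w.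
Proof. by rewrite /word_inv map_rcons rev_rcons. Qed.

Lemma word_inv_letters w a : a \in word_inv w -> linv a \in w.
Proof. by rewrite mem_rev => /mapP[b bw ->]; rewrite linvK. Qed.

Lemma size_word_inv w : size (word_inv w) = size w.
Proof. by rewrite size_rev size_map. Qed.

Lemma head_word_inv w a0 : w != [::] ->
  head a0 (word_inv w) = linv (last a0 w).
Proof. by case/lastP: w => // w a _; rewrite word_inv_rcons last_rcons. Qed.

Lemma last_word_inv w a0 : w != [::] ->
  last a0 (word_inv w) = linv (head a0 w).
Proof. by case: w => // a w _; rewrite word_inv_cons last_rcons. Qed.

Lemma word_inv_reduced w : reduced w -> reduced (word_inv w).
Proof.
elim: w => //= a w IHw rw; rewrite word_inv_cons -cats1.
have rw' := reduced_tail rw.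
apply: (@reduced_cat _ _ a); rewrite ?IHw //.
case: (eqVneq w [::]) => [->|w0]; first by left.
right; right; rewrite last_word_inv //= linvK.
by case: (w) w0 rw => //= b w2 _ /andP[+ _]; rewrite eq_sym.
Qed.

(** Cancellation happens only at the seam, so [u1 ++ v1] is the normal form of the product. Such
    splittings later serve to compare geodesics of the tree. *)
Lemma cancellation u v : reduced u -> reduced v ->
  exists u1 c v1, [/\ u = u1 ++ c, v = word_inv c ++ v1 & reduced (u1 ++ v1)].
Proof.
elim/last_ind: u v => [|u a IHu] v ru rv; first by exists [::], [::], v.
case: v rv => [|b v] rv; first by exists (rcons u a), [::], [::]; rewrite !cats0.
case: (eqVneq b (linv a)) => [ba|ba].
  have [||u1 [c [v1 [uE vE r1]]]] := IHu v.
  - by move: ru; rewrite -cats1 => /reduced_catl.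
  - by move: rv; rewrite -cat1s => /reduced_catr.
  by exists u1, (rcons c a), v1; rewrite word_inv_rcons ba vE uE rcons_cat.
exists (rcons u a), [::], (b :: v); rewrite cats0; split=> //.
by apply: (@reduced_cat _ _ a) => //=; right; right; rewrite last_rcons.
Qed.

Lemma of_word_catV u c v :
  of_word (u ++ c) * of_word (word_inv c ++ v) = of_word (u ++ v).
Proof. by rewrite !of_wordM of_word_inv !mulgA mulgK. Qed.

Lemma of_word1 (x : X) (b : bool) : of_word [:: (x, b)] = if b then (fgen x)^-1 else fgen x.
Proof. by case: b => //; rewrite -of_word_linv. Qed.

Section OneLetter.
Variable x : X.
Local Notation xletter := (fun a => a.1 == x).

Lemma xword_gen w : all xletter w -> gen [set fgen x] (of_word w).
Proof.
elim: w => [_|[y b] w IHw /= /andP[/eqP /= -> aw]]; first exact: gen1.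
rewrite of_word_cons; apply: genM; last exact: IHw.
by rewrite of_word1; case: b; [apply: genV|]; apply: sub_gen.
Qed.

Lemma gen_xword g : gen [set fgen x] g ->
  exists w, [/\ reduced w, all xletter w & of_word w = g].
Proof.
move=> gg; elim/gen_ind_r: g / gg => [|_ _ [w [rw aw <-]] ->|_ _ [w [rw aw <-]] ->].
- by exists [::].
- exists (nf (rcons w (x, false))); split; first exact: nf_reduced.
    apply/allP => a /nf_letters; rewrite mem_rcons inE => /orP[/eqP -> //|].
    by move/allP: aw; apply.
  by rewrite of_nf -cats1 of_wordM.
- exists (nf (rcons w (x, true))); split; first exact: nf_reduced.
    apply/allP => a /nf_letters; rewrite mem_rcons inE => /orP[/eqP -> //|].
    by move/allP: aw; apply.
  by rewrite of_nf -cats1 of_wordM of_word1.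
Qed.

(** Quantifying over the default [a0] makes the second alternative imply that [v] is nonempty:
    otherwise a default with first component [x] would refute it. *)
Lemma strip_prefix w : exists u v,
  [/\ w = u ++ v, all xletter u & v = [::] \/ forall a0, ~~ xletter (head a0 v)].
Proof.
elim: w => [|a w [u [v [-> au v0]]]]; first by exists [::], [::]; split=> //; left.
case: (boolP (xletter a)) => xa.
  by exists (a :: u), v; rewrite /= xa.
by exists [::], (a :: u ++ v); split=> //; right.
Qed.

Lemma strip_suffix w : exists u v,
  [/\ w = u ++ v, all xletter v & u = [::] \/ forall a0, ~~ xletter (last a0 u)].
Proof.
elim/last_ind: w => [|w a [u [v [-> au v0]]]].
  by exists [::], [::]; split=> //; left.
case: (boolP (xletter a)) => xa.
  by exists u, (rcons v a); rewrite rcons_cat all_rcons xa.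
by exists (rcons (u ++ v) a), [::]; rewrite cats0; split=> //; right=> a0;
  rewrite last_rcons.
Qed.

(** Without its leading [x]-letters, [g] becomes some [v] that still commutes with x^n. The word x^n
    v is reduced and begins with [x], whereas v x^n begins with the first letter of [v] unless all
    of [v] cancels against x^n. Either way a nonempty [v] would begin with an [x]-letter. *)
Lemma free_commute_gen_pow g n : (0 < n)%N -> commute g (fgen x ^+ n) ->
  gen [set fgen x] g.
Proof.
move=> n0 cg; have [u [v [gE au v0]]] := strip_prefix (nform g).
have gE' : g = of_word u * of_word v by rewrite -of_wordM -gE of_nform.
have gu := xword_gen au.
have [v0'|hv] : v = [::] \/ forall a0, ~~ xletter (head a0 v) by [].
  by rewrite gE' v0' mulg1.
have rv : reduced v by apply: (@reduced_catr u); rewrite -gE nform_reduced.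
have cu : commute (fgen x ^+ n) (of_word u).
  by apply: commute_gen gu => _ ->; apply/commute_sym/commuteX.
have : commute (of_word v) (fgen x ^+ n).
  have -> : of_word v = (of_word u)^-1 * g by rewrite gE' mulKg.
  by apply/commute_sym/commuteM; [apply: commuteV | apply: commute_sym].
pose e := nseq n (x, false).
have eE : of_word e = fgen x ^+ n.
  rewrite /e; elim: (n) => // k IHk.
  by rewrite -[nseq _ _]/((x, false) :: nseq k (x, false)) of_word_cons IHk expgS.
have re : reduced e by apply: nseq_reduced.
have vn0 : v != [::].
  by apply/eqP => vnil; have := hv (x, false); rewrite vnil eqxx.
have rev : reduced (e ++ v).
  apply: (@reduced_cat _ _ (x, false)) => //; right; right.
  have -> : last (x, false) e = (x, false) by rewrite /e; elim: (n).
  by apply/eqP => hE; have := hv (x, false); rewrite hE eqxx.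
have [u1 [c [v1 [vE eE' r1]]]] := cancellation rv re.
rewrite -eE /commute {1}vE {1}eE' of_word_catV -of_wordM.
move=> /(congr1 nform); rewrite !nform_reducedE // => eq.
exfalso; have := hv (x, false); case: (eqVneq u1 [::]) => u10.
  move: vE; rewrite u10 /= => vc.
  have : head (x, false) v \in v by case: (v) vn0 => //= ? ? _; rewrite mem_head.
  rewrite {2}vc -[c]word_invK => /word_inv_letters hc.
  have : linv (head (x, false) v) \in e by rewrite eE' mem_cat hc.
  by rewrite mem_nseq => /andP[_ /eqP/(congr1 fst) /= ->]; rewrite eqxx.
rewrite vE; case: (u1) u10 eq => //= a u2 _; rewrite /e.
by case: (n) n0 => //= k _ [-> _]; rewrite eqxx.
Qed.

End OneLetter.
End NormalForm.

(** * Two-generator subgroups of a free group *)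

Section Powers.
Variable X : choiceType.
Local Notation word := (seq (X * bool)).
Implicit Types (a b : X * bool) (u v w r : word).

(* Writing [r] as [c u c^-1] with [u] cyclically reduced, the power is [c u^n c^-1]. *)
Lemma power_reduced a0 r n : reduced r -> r != [::] -> (0 < n)%N ->
  exists s, [/\ reduced s, of_word s = of_word r ^+ n,
    head a0 s = head a0 r /\ last a0 s = last a0 r & (size r <= size s)%N].
Proof.
move=> + + n0; have [k] := ubnP (size r).
elim: k r => // k IHr r; rewrite ltnS => szk rr r0.
case: (eqVneq (head a0 r) (linv (last a0 r))) => hl; last first.
  clear IHr; case: n n0 => // n _; elim: n => [|n [s [rs sE [hs ls] szs]]].
    by exists r; rewrite expg1.
  have s0 : s != [::] by case: (s) szs r0 => //; case: (r).
  exists (r ++ s); split.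
  - by apply: (@reduced_cat _ _ _ a0) => //; right; right; rewrite hs.
  - by rewrite of_wordM sE -expgS.
  - split; first by case: (r) r0.
    by rewrite last_cat -ls; case: (s) s0.
  - by rewrite size_cat leq_addr.
case: r r0 => // a r _ in szk rr hl *; case/lastP: r => [|r b] in szk rr hl *.
  by move: hl => /= /eqP; rewrite eq_sym linv_neq.
have ba : b = linv a by move: hl; rewrite /= last_rcons => ->; rewrite linvK.
have rar : reduced (a :: r) by apply: (@reduced_catl _ _ [:: b]); rewrite /= cats1.
have rrb : reduced (rcons r b) by apply: reduced_tail rr.
have rr' := reduced_tail rar.
have r0 : r != [::].
  by apply/eqP => rE; move: rr; rewrite rE /reduced /= ba eqxx.
have [|s [rs sE [hs ls] szs]] := IHr r _ rr' r0.
  by move: szk; rewrite /= size_rcons; apply: leq_trans.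
have s0 : s != [::] by case: (s) szs r0 => //; case: (r).
exists (a :: rcons s b); split.
- rewrite -cat1s -cats1; apply: (@reduced_cat _ _ _ a0) => //; last first.
    right; right; rewrite /=; have := @reduced_junction _ [:: a] r a0 rar.
    by move=> /(_ isT r0); rewrite -hs; case: (s) s0.
  apply: (@reduced_cat _ _ _ a0) => //; right; right; rewrite ls.
  by have := @reduced_junction _ r [:: b] a0; rewrite cats1; apply.
- rewrite -cats1 of_word_cons of_wordM sE.
  rewrite -(cats1 r) (of_word_cons a (r ++ _)) of_wordM ba of_word_linv.
  have conj (x y : free_group X) : (x * (y / x)) ^+ n = x * (y ^+ n / x).
    by have := conjXg y x^-1 n; rewrite /conjg groupVK => ->.
  by rewrite conj.
- by rewrite /= !last_rcons.
- by rewrite /= !size_rcons !ltnS.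
Qed.

Section Pair.
Variables (x : X) (w : word).
Local Notation xletter := (fun a => a.1 == x).
Hypothesis rw : reduced w.
Hypothesis hw : forall a0, ~~ xletter (head a0 w).
Hypothesis lw : forall a0, ~~ xletter (last a0 w).
Hypothesis sw : (1 < size w)%N.

(** Plays the part of a nonzero power of [w]. The exponent is forgotten, since merging two powers
    only requires membership in the cyclic group. *)
Definition block r := [/\ reduced r, forall a0, ~~ xletter (head a0 r),
  forall a0, ~~ xletter (last a0 r), (1 < size r)%N
  & gen [set of_word w] (of_word r)].

Lemma gen_block g : gen [set of_word w] g ->
  g = 1 \/ exists2 r, block r & of_word r = g.
Proof.
have w0 : w != [::] by case: (w) sw.
have pos n : (0 < n)%N -> exists2 r, block r & of_word r = of_word w ^+ n.
  move=> n0; have a0 : X * bool by case: (w) w0.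
  have [r [rr rE [hr lr] sr]] := power_reduced a0 rw w0 n0.
  have r0 : r != [::] by case: (r) sr w0 => //; case: (w).
  exists r => //; split=> //.
  - by move=> a1; have := hw a0; rewrite -hr; case: (r) r0.
  - by move=> a1; have := lw a0; rewrite -lr; case: (r) r0.
  - exact: leq_trans sr.
  - by rewrite rE; apply: genX; apply: sub_gen.
case/gen1P => -[|n] [] ->; rewrite ?expg0 ?invg1; try by left.
  by right; apply: pos.
right; have [r [rr hr lr sr gr] rE] := pos n.+1 isT.
have r0 : r != [::] by case: (r) sr.
exists (word_inv r); last by rewrite of_word_inv rE.
split; first exact: word_inv_reduced.
- by move=> a0; rewrite head_word_inv //; apply: lr.
- by move=> a0; rewrite last_word_inv //; apply: hr.
- by rewrite size_word_inv.
- by rewrite of_word_inv; apply: genV.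
Qed.

(* Powers of [w] begin and end with letters other than [x], so they never
   cancel against powers of [x]. *)
Inductive good : word -> Prop :=
| good_xword t : reduced t -> all xletter t -> good t
| good_block u r t : good u -> u = [::] \/ (forall a0, xletter (last a0 u)) ->
    block r -> reduced t -> all xletter t -> good (u ++ r ++ t).

Lemma all_xletterP t : all xletter t -> t != [::] ->
  forall a0, xletter (head a0 t) /\ xletter (last a0 t).
Proof.
move=> at_ t0 a0; split.
  by case: t at_ t0 => //= a t /andP[].
by case/lastP: t at_ t0 => //= t a; rewrite all_rcons last_rcons => /andP[].
Qed.

Lemma good_reduced u : good u -> reduced u /\ (all xletter u \/ (1 < size u)%N).
Proof.
elim=> [t rt at_|{}u r t _ [ru _] lu [rr hr lr sr _] rt at_].
  by split=> //; left.
split; last by right; rewrite !size_cat addnCA ltn_addr.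
have neq a b : xletter a -> ~~ xletter b -> b != linv a /\ a != linv b.
  by move=> xa xb; split; apply: contra xb => /eqP ab; move: xa; rewrite ab.
have r0 : r != [::] by case: (r) sr.
have a0 : X * bool by case: (r) sr.
apply: (@reduced_cat _ _ _ a0) => //; last first.
  case: lu => [->|lu]; [by left|right; right].
  by case: (neq _ _ (lu a0) (hr a0)); case: (r) r0.
apply: (@reduced_cat _ _ _ a0) => //.
case: (eqVneq t [::]) => t0; [by right; left|right; right].
by have [] := neq _ _ (all_xletterP at_ t0 a0).1 (lr a0).
Qed.

(** Right multiplication by a power of [x] changes only the final [x]-syllable. A power of [w] is
    appended as a new block, or, when that syllable is empty, merges with the last block, which may
    then disappear. *)
Lemma gen_good g : gen [set of_word w; fgen x] g ->
  exists2 u, good u & of_word u = g.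
Proof.
have stepx u y : good u -> gen [set fgen x] y ->
    exists2 u', good u' & of_word u' = of_word u * y.
  case=> [t rt at_|{}u r t gu lu br rt at_] gy.
    have /gen_xword[t' [rt' at' <-]] : gen [set fgen x] (of_word t * y).
      by apply: genM => //; apply: xword_gen.
    by exists t' => //; apply: good_xword.
  have /gen_xword[t' [rt' at' t'E]] : gen [set fgen x] (of_word t * y).
    by apply: genM => //; apply: xword_gen.
  exists (u ++ r ++ t'); first exact: good_block.
  by rewrite !of_wordM t'E !mulgA.
have stepw u y : good u -> gen [set of_word w] y ->
    exists2 u', good u' & of_word u' = of_word u * y.
  move=> gu gy.
  have new : u = [::] \/ (forall a0, xletter (last a0 u)) ->
      exists2 u', good u' & of_word u' = of_word u * y.
    move=> lu; case: (gen_block gy) => [->|[r br <-]].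
      by exists u; rewrite ?mulg1.
    exists (u ++ r ++ [::]); first exact: good_block.
    by rewrite cats0 of_wordM.
  case: gu new => [t rt at_|{}u r t gu lu br rt at_] new.
    case: (eqVneq t [::]) => t0; first by apply: new; left.
    by apply: new; right=> a0; case: (all_xletterP at_ t0 a0).
  case: (eqVneq t [::]) => t0; last first.
    apply: new; right=> a0; rewrite !last_cat.
    by have [_] := all_xletterP at_ t0 (last (last a0 u) r).
  have gr : gen [set of_word w] (of_word r * y) by apply: genM => //; case: br.
  rewrite t0 cats0 of_wordM -mulgA.
  case: (gen_block gr) => [->|[r' br' <-]]; first by exists u; rewrite ?mulg1.
  exists (u ++ r' ++ [::]); first exact: good_block.
  by rewrite cats0 of_wordM.
move=> gg; elim/gen_ind_r: g / gg.
- by exists [::] => //; apply: good_xword.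
- by move=> _ _ [u gu <-] [] ->; [apply: stepw|apply: stepx] => //; apply: sub_gen.
- by move=> _ _ [u gu <-] [] ->; [apply: stepw|apply: stepx] => //; apply: genV; apply: sub_gen.
Qed.

(** A good word is reduced, and it is either spelled in [x] alone or longer than one letter; the
    word [y] is neither. *)
Lemma gen_pair_proper y : y != x -> ~ gen [set of_word w; fgen x] (fgen y).
Proof.
move=> yx /gen_good[u /good_reduced[ru su] /(congr1 (@nform X))].
rewrite nform_reducedE // nform_reducedE // => uE.
by case: su; rewrite uE //= (negbTE yx).
Qed.

End Pair.
End Powers.

(** Powers of the generator [false] at the two ends of [u] do not affect the group generated. The
    remaining core begins and ends with [true] or its inverse: if it is empty the group is cyclic,
    and if it has two letters or more [gen_pair_proper] applies. *)
Lemma free_bool_basis (u : free_group bool) :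
  gen [set u; fgen false] (fgen true) ->
  exists a b, [/\ gen [set fgen false] a, gen [set fgen false] b
    & u = a * fgen true * b \/ u = a * (fgen true)^-1 * b].
Proof.
have [s [v [uE as_ hv]]] := strip_prefix false (nform u).
have [w [t [vE at_ lw]]] := strip_suffix false v.
have ru : reduced (s ++ w ++ t) by rewrite -vE -uE nform_reduced.
have rw : reduced w by apply: reduced_catl (reduced_catr ru).
have {}uE : u = of_word s * of_word w * of_word t.
  by rewrite -(of_nform u) uE vE !of_wordM mulgA.
have gs := xword_gen as_; have gt := xword_gen at_.
move=> gu; have {}gu : gen [set of_word w; fgen false] (fgen true).
  apply: gen_sub gu => _ [] ->; last by apply: sub_gen; right.
  rewrite uE; apply: genM; first apply: genM.
  - by apply: gen_mono gs => _ ->; right.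
  - by apply: sub_gen; left.
  - by apply: gen_mono gt => _ ->; right.
have neq : true != false by [].
have [w0|w0] := eqVneq w [::].
  have := gu; rewrite w0 => {}gu; exfalso.
  have /gen_xword[r [rr ar /(congr1 (@nform _))]] :
      gen [set fgen false] (fgen true : free_group bool).
    by apply: gen_sub gu => _ [] ->; [apply: gen1|apply: sub_gen].
  by rewrite !nform_reducedE // => rE; rewrite rE in ar.
have {}lw a0 : (last a0 w).1 != false.
  by case: lw => [wn|]; [rewrite wn in w0 | apply].
have hw a0 : (head a0 w).1 != false.
  case: hv => [vn|/(_ a0)]; first by move: w0; rewrite -size_eq0; move: vE; rewrite vn; case: (w).
  by rewrite vE; case: (w) w0.
exists (of_word s), (of_word t); split=> //.
case: (w) w0 hw lw rw gu uE => // -[x b] [|c r] _ hw lw rw gu uE; last first.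
  by have := @gen_pair_proper _ false _ rw hw lw isT true neq.
have := hw (x, b); rewrite /=; case: x {hw lw rw gu} uE => // -> _.
by rewrite of_word1; case: b; [right|left].
Qed.

(** * Integral classes and the Heisenberg group *)

Section Additive.
Variable G : groupType.

Definition additive_to_int (f : G -> int) := forall x y, f (x * y) = (f x + f y)%R.

Variable f : G -> int.
Hypothesis fM : additive_to_int f.

Lemma additive1 : f 1 = 0%R.
Proof. by have /eqP := fM 1 1; rewrite mulg1 -subr_eq0 opprD addrA subrr sub0r oppr_eq0 => /eqP. Qed.

Lemma additiveV x : f x^-1 = (- f x)%R.
Proof. by apply/eqP; rewrite -addr_eq0 -fM mulVg additive1. Qed.

Lemma additiveJ x y : f (x ^ y) = f x.
Proof. by rewrite /conjg !fM additiveV addrC addrK. Qed.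

Lemma additiveX x n : f (x ^+ n) = (f x *+ n)%R.
Proof.
by elim: n => [|n IHn]; rewrite ?expg0 ?additive1 ?mulr0n // expgS fM IHn mulrS.
Qed.

Lemma additive_gen (A : set G) x : (forall a, A a -> f a = 0%R) -> gen A x -> f x = 0%R.
Proof.
move=> fA; apply: (@gen_min _ _ [set y | f y = 0%R]) => //; split=> /=.
- exact: additive1.
- by move=> y z; rewrite fM => -> ->; rewrite addr0.
- by move=> y; rewrite additiveV => ->; rewrite oppr0.
Qed.

End Additive.

Lemma additive_comp (G H : groupType) (h : {multiplicative G -> H}) (f : H -> int) :
  additive_to_int f -> additive_to_int (f \o h).
Proof. by move=> fM x y; rewrite /= gmulfM fM. Qed.

Lemma additive_eq (G : groupType) (f g : G -> int) (A : set G) x :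
  additive_to_int f -> additive_to_int g -> (forall a, A a -> f a = g a) ->
  gen A x -> f x = g x.
Proof.
move=> fM gM fgA; apply: (@gen_min _ _ [set y | f y = g y]) => //; split=> /=.
- by rewrite !additive1.
- by move=> y z; rewrite fM gM => -> ->.
- by move=> y; rewrite !additiveV // => ->.
Qed.

(* The Heisenberg group with the antisymmetric cocycle, for which
   n |-> (n a, n b, 0) is a morphism. A pair of classes in degree 1 has zero
   cup product exactly when it lifts to this group, up to 2-torsion. *)
Definition heis : Type := (int * int * int)%type.
HB.instance Definition _ := Choice.on heis.

Section Heisenberg.
Implicit Types x y z : heis.

Definition heis_mul x y : heis :=
  (x.1.1 + y.1.1, x.1.2 + y.1.2, x.2 + y.2 + (x.1.1 * y.1.2 - x.1.2 * y.1.1))%R.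
Definition heis_inv x : heis := (- x.1.1, - x.1.2, - x.2)%R.

Fact heis_mulA : associative heis_mul.
Proof.
by move=> [[a b] c] [[a' b'] c'] [[a2 b2] c2]; rewrite /heis_mul /=;
  congr (_, _, _); ring.
Qed.

Fact heis_mul1 : left_id ((0, 0, 0)%R : heis) heis_mul.
Proof. by move=> [[a b] c]; rewrite /heis_mul /=; congr (_, _, _); ring. Qed.

Fact heis_1mul : right_id ((0, 0, 0)%R : heis) heis_mul.
Proof. by move=> [[a b] c]; rewrite /heis_mul /=; congr (_, _, _); ring. Qed.

Fact heis_mulV : left_inverse ((0, 0, 0)%R : heis) heis_inv heis_mul.
Proof. by move=> [[a b] c]; rewrite /heis_mul /=; congr (_, _, _); ring. Qed.

Fact heis_Vmul : right_inverse ((0, 0, 0)%R : heis) heis_inv heis_mul.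
Proof. by move=> [[a b] c]; rewrite /heis_mul /=; congr (_, _, _); ring. Qed.

HB.instance Definition _ := isGroup.Build heis
  heis_mulA heis_mul1 heis_1mul heis_mulV heis_Vmul.

Lemma heisM x y : x * y = heis_mul x y. Proof. by []. Qed.

Lemma heis_commute x y :
  commute x y -> (x.1.1 * y.1.2 = x.1.2 * y.1.1)%R.
Proof.
case: x y => [[a b] c] [[a' b'] c'] /(congr1 snd) /=; lia.
Qed.

Lemma heis_fst_additive : additive_to_int (fun x => x.1.1).
Proof. by []. Qed.

Lemma heis_snd_additive : additive_to_int (fun x => x.1.2).
Proof. by []. Qed.

End Heisenberg.

Lemma heis_of_additive (G : groupType) (a b : G -> int) :
  additive_to_int a -> additive_to_int b ->
  (forall x y, a x * b y = b x * a y)%R ->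
  exists h : {multiplicative G -> heis}, forall x, h x = (a x, b x, 0%R).
Proof.
move=> aM bM ab.
have [|h hE] := @multiplicative_of G heis (fun x => (a x, b x, 0%R)).
  by move=> x y; rewrite heisM /heis_mul aM bM; congr (_, _, _); rewrite /= ab; lia.
by exists h => x; rewrite hE.
Qed.

Lemma raag_additive (Gamma : sgraph) (c : Gamma -> int) :
  exists f : raag Gamma -> int, additive_to_int f /\ forall u, f (raag_gen u) = c u.
Proof.
(* The triples (c, 0, 0) are a multiplicative copy of Z inside the Heisenberg group. *)
have [|h hE] := @raag_lift Gamma heis (fun u => (c u, 0, 0)%R).
  by move=> u w _; rewrite /commute !heisM /heis_mul; congr (_, _, _) => /=; lia.
exists (fun x => (h x).1.1); split=> [x y|u]; last by rewrite hE.
by rewrite gmulfM.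
Qed.

(* Up to 2-torsion, the class [a] has zero cup product with every class
   vanishing at [y]. *)
Definition cup_isolated (G : groupType) (y : G) :=
  exists a : G -> int, [/\ additive_to_int a, a y = 0%R, exists x, a x <> 0%R &
    forall b : G -> int, additive_to_int b -> b y = 0%R ->
    exists h : {multiplicative G -> heis},
      forall x, (h x).1.1 = a x /\ (h x).1.2 = b x].

Lemma cup_isolated_morph (G H : groupType) (f : {multiplicative G -> H})
    (g : {multiplicative H -> G}) y :
  cancel f g -> cancel g f -> cup_isolated (f y) -> cup_isolated y.
Proof.
move=> fK gK [a [aM ay [x ax] ab]]; exists (a \o f); split=> //.
- exact: additive_comp.
- by exists (g x); rewrite /= gK.
- move=> b bM by0; have [||h hE] := ab (b \o g); rewrite /= ?fK //.
    exact: additive_comp.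
  by exists (h \o f : {multiplicative G -> heis}) => u /=; have [-> ->] := hE (f u); rewrite /= fK.
Qed.

Lemma presented_relator (X : choiceType) (R : set (free_group X)) r :
  R r -> to_quot (ncl_normal_of R) r = 1.
Proof.
move=> Rr; apply/esym/to_quotP; rewrite invg1 mul1g => N [_]; exact.
Qed.

Section FreeProductInjections.
Variables H K : groupType.

Lemma free_product_inl :
  {morph (fun x => pgen (@free_product_relators H K) (inl x)) : x y / x * y}.
Proof.
move=> x y; apply/esym/divg1_eq; rewrite /pgen.
have [pr prE] := multiplicative_of (@to_quot_morph _ (ncl_normal_of (@free_product_relators H K))).
rewrite -!prE -multV -!gmulfM prE; apply: presented_relator.
by left; exists (x, y).
Qed.

Lemma free_product_inr :
  {morph (fun x => pgen (@free_product_relators H K) (inr x)) : x y / x * y}.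
Proof.
move=> x y; apply/esym/divg1_eq; rewrite /pgen.
have [pr prE] := multiplicative_of (@to_quot_morph _ (ncl_normal_of (@free_product_relators H K))).
rewrite -!prE -multV -!gmulfM prE; apply: presented_relator.
by right; exists (x, y).
Qed.

End FreeProductInjections.

Lemma int_additive (e : int -> int) : (forall m n, e (m + n) = e m + e n)%R ->
  forall n, (e n = n * e 1)%R.
Proof.
move=> eD; have e0 : (e 0 = 0)%R by have := eD 0%R 0%R; rewrite addr0; lia.
elim/int_rec => [|n IHn|n IHn]; first by rewrite mul0r.
  by rewrite -addn1 PoszD eD IHn mulrDl mul1r.
have := eD (- n.+1%:Z)%R 1%R.
have -> : (- n.+1%:Z + 1 = - n%:Z)%R by lia.
rewrite IHn; lia.
Qed.

(** A class [b] vanishing at [y] descends to the free product. On the factor Z it is a multiple of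
    the dual class [a], and on the other factor [a] is zero; so the pair lifts on each factor, and
    the universal property glues the lifts. *)
Lemma splits_off_Z_cup_isolated (G : groupType) (y : G) :
  splits_off_Z (quot (ncl_normal_of [set y])) -> cup_isolated y.
Proof.
move=> [H [K [[z [[e ze ez] zM]] _ [phi [psi phiK psiK]]]]].
set N := ncl_normal_of [set y] in phi psi phiK psiK.
have [pr prE] := multiplicative_of (@to_quot_morph _ N).
have [psi' psi'E] := multiplicative_of (can2_gmulfM phiK psiK).
have eM : additive_to_int e.
  by move=> u v; rewrite -{1}(ez u) -{1}(ez v) -zM ze.
have zero_add (L : groupType) : additive_to_int (fun _ : L => 0%R) by [].
have [|aH aHE] := @heis_of_additive H e (fun=> 0%R) eM (zero_add _).
  by move=> u v; rewrite mulr0 mul0r.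
have [aK aKE] := @heis_of_additive K (fun=> 0%R) (fun=> 0%R) (zero_add _) (zero_add _) (fun _ _ => erefl).
have [al [alH alK]] := free_product_lift aH aK.
pose a x := (al (phi (pr x))).1.1.
have aM : additive_to_int a by move=> u v; rewrite /a !gmulfM.
exists a; split=> //.
- rewrite /a prE; have -> : to_quot N y = to_quot N 1.
    apply/esym/to_quotP; rewrite invg1 mul1g; by move=> M [_]; apply.
  by rewrite -prE !mult1.
- exists (repr (psi (pgen _ (inl (z 1%R))))).
  by rewrite /a prE repr_quotK psiK alH aHE /= ze.
move=> b bM by0.
have [|B BE] := @heis_of_additive G (fun=> 0%R) b (zero_add _) bM.
  by move=> u v; rewrite mulr0 mul0r.
have [|B' B'E] := @quot_lift G heis N B.
  move=> x /(_ [set x | B x = 1]); apply; split; last by move=> _ -> /=; rewrite BE by0.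
  split; first split=> /=; first exact: mult1.
  - by move=> u v; rewrite gmulfM => -> ->; rewrite mulg1.
  - by move=> u; rewrite multV => ->; rewrite invg1.
  - by move=> u v /=; rewrite multJ => ->; rewrite conj1g.
pose be w := (B' (psi' w)).1.2.
have beM : additive_to_int be by move=> u v; rewrite /be !gmulfM.
have beH : additive_to_int (fun x => be (pgen _ (inl x))).
  by move=> u v; rewrite free_product_inl beM.
have beK : additive_to_int (fun x => be (pgen _ (inr x))).
  by move=> u v; rewrite free_product_inr beM.
have beHE x : be (pgen _ (inl x)) = (e x * be (pgen _ (inl (z 1%R))))%R.
  rewrite -{1}(ez x).
  apply: (@int_additive (fun n => be (pgen (@free_product_relators H K) (inl (z n))))).
  by move=> m n; rewrite zM beH.
have [|hH hHE] := @heis_of_additive H e (fun x => be (pgen _ (inl x))) eM beH.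
  by move=> u v; rewrite (beHE u) (beHE v) mulrA mulrAC.
have [|hK hKE] := @heis_of_additive K (fun=> 0%R) (fun x => be (pgen _ (inr x))) (zero_add _) beK.
  by move=> u v; rewrite mulr0 mul0r.
have [h [hl hr]] := free_product_lift hH hK.
have gw w : gen (range (pgen (@free_product_relators H K))) w by rewrite presented_gen.
have bE x : b x = be (phi (pr x)) by rewrite /be psi'E phiK prE B'E BE.
have prod_add (f : heis -> int) (k : {multiplicative free_product H K -> heis}) :
    additive_to_int f -> additive_to_int (fun w => f (k w)).
  by move=> fM u v; rewrite gmulfM fM.
exists (h \o (phi \o pr) : {multiplicative G -> heis}) => x; split=> /=; last first.
  rewrite bE; move: (gw (phi (pr x))).
  apply: (additive_eq (prod_add _ h heis_snd_additive) beM) => _ [[u|u] _ <-].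
    by rewrite hl hHE.
  by rewrite hr hKE.
rewrite /a; move: (gw (phi (pr x))).
apply: (additive_eq (prod_add _ h heis_fst_additive) (prod_add _ al heis_fst_additive)) => _ [[u|u] _ <-].
  by rewrite hl hHE alH aHE.
by rewrite hr hKE alK aKE.
Qed.

(** Let [u] be in the support of [a], with a neighbour [w] other than [i]. The class dual to [w]
    vanishes at [y], so it lifts together with [a]. The images of [u] and [w] commute, which forces
    a(u) = 0 because the dual class is 1 at [w] and 0 at [u]. *)
Lemma raag_cup_isolated (Gamma : sgraph) (y : raag Gamma) (i : Gamma) :
  (forall f : raag Gamma -> int, additive_to_int f ->
     f y = 0%R <-> f (raag_gen i) = 0%R) ->
  cup_isolated y -> exists u : Gamma, u <> i /\ forall w, edge u w -> w = i.
Proof.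
move=> yi [a [aM ay [x ax] ab]].
have [u au] : exists u, a (raag_gen u) <> 0%R.
  apply: contrapT => none; apply: ax.
  apply: (additive_gen aM _ (raag_generated x)) => _ [u _ <-].
  by apply: contrapT => au; apply: none; exists u.
exists u; split=> [ui|w uw]; first by apply: au; rewrite ui; exact/(yi a aM).
apply: contrapT => wi.
have [b [bM bE]] := raag_additive (fun v : Gamma => Posz (v == w)).
have [|h hE] := ab b bM.
  by apply/(yi b bM); rewrite bE; case: eqP => // iw; case: wi.
have := heis_commute (gmulf_commute h (raag_edge_commute uw)).
rewrite !(hE _).1 !(hE _).2 !bE eqxx mulr1.
case: eqP => [uw'|_]; first by move: uw; rewrite uw' edge_irr.
by rewrite mul0r.
Qed.

(** * Splitting off one vertex *)

Section FreeGroupMap.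
Variables (X : choiceType) (s : X -> X).
Hypothesis s_inj : injective s.
Local Notation word := (seq (X * bool)).

Definition map_word (w : word) : word := [seq (s a.1, a.2) | a <- w].

Lemma map_word_reduced w : reduced w -> reduced (map_word w).
Proof.
rewrite /reduced /map_word sorted_map; apply: sub_sorted => -[x b] [y c] /=.
apply: contra => /eqP [/s_inj -> ->]; exact: eqxx.
Qed.

Lemma nform_morph (h : {multiplicative free_group X -> free_group X}) g :
  (forall x, h (fgen x) = fgen (s x)) -> nform (h g) = map_word (nform g).
Proof.
move=> hE; have hw w : h (of_word w) = of_word (map_word w).
  elim: w => [|[x b] w IHw] /=; first exact: mult1.
  rewrite (of_word_cons (x, b)) gmulfM IHw (of_word_cons (s x, b)); congr ( _ * _).
  by rewrite !of_word1; case: b; rewrite ?multV hE.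
rewrite -{1}(of_nform g) hw nform_reducedE //.
exact/map_word_reduced/nform_reduced.
Qed.

End FreeGroupMap.

(* Naming the instance avoids a reverse coercion from [set G] to [choiceType]. *)
Local Notation subsets G :=
  (@SetOrder.Internal.classical_sets_set__canonical__choice_Choice G).

Section Translates.
Variable G : groupType.
Implicit Types (g h : G) (A : set G).

Definition translate g A : set G := [set x | A (g^-1 * x)].

Lemma translate1 A : translate 1 A = A.
Proof. by apply/funext => x; rewrite /translate /mkset invg1 mul1g. Qed.

Lemma translateM g h A : translate (g * h) A = translate g (translate h A).
Proof. by apply/funext => x; rewrite /translate /mkset groupVM mulgA. Qed.

Lemma translate_inj g : injective (translate g).
Proof.
by move=> A B /(congr1 (translate g^-1)); rewrite -!translateM mulVg !translate1.
Qed.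

Lemma translate_subgroup A g : is_subgroup A -> translate g A = A <-> A g.
Proof.
move=> sA; split=> [gA|Ag]; first by rewrite -gA /translate /= mulVg; case: sA.
apply/seteqP; split=> x; rewrite /translate /= => Ax.
  by rewrite -(mulVKg g x); apply: subgroupM.
by apply: subgroupM => //; apply: subgroupV.
Qed.

Lemma translate_eq A g h : is_subgroup A ->
  translate g A = translate h A <-> A (g^-1 * h).
Proof.
move=> sA; rewrite -(translate_subgroup _ sA) translateM; split.
  by move=> <-; rewrite -translateM mulVg translate1.
by move=> /(congr1 (translate g)); rewrite -translateM mulgV translate1.
Qed.

Definition shift g : {multiplicative free_group (subsets G) -> free_group (subsets G)} :=
  projT1 (cid (free_lift_gen (fun A => fgen (translate g A)))).

Lemma shift_gen g A : shift g (fgen A) = fgen (translate g A).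
Proof. by rewrite /shift; case: cid. Qed.

Lemma free_ext (X : choiceType) (H : groupType)
    (h k : {multiplicative free_group X -> H}) :
  (forall x, h (fgen x) = k (fgen x)) -> h =1 k.
Proof.
move=> hk x; apply: (@eq_on_gen _ _ _ _ (range (@fgen X))) => [_ [y _ <-] //|].
by rewrite free_gen.
Qed.

Lemma shift1 f : shift 1 f = f.
Proof.
have : shift 1 =1 (idfun : {multiplicative _ -> _}).
  by apply: free_ext => A; rewrite shift_gen translate1.
exact.
Qed.

Lemma shiftM g h f : shift (g * h) f = shift g (shift h f).
Proof.
have : shift (g * h) =1 (shift g \o shift h : {multiplicative _ -> _}).
  by apply: free_ext => A; rewrite /= !shift_gen translateM.
exact.
Qed.

Lemma nform_shift g f : nform (shift g f) = map_word (translate g) (nform f).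
Proof. by apply: nform_morph; [apply: translate_inj | apply: shift_gen]. Qed.

End Translates.

(* Only the translates of one subgroup occur as letters; allowing all subsets
   avoids a type of cosets. *)
Definition semidirect (G : groupType) : Type := (free_group (subsets G) * G)%type.
HB.instance Definition _ (G : groupType) := Choice.on (semidirect G).

Section Semidirect.
Variable G : groupType.
Local Notation SD := (semidirect G).
Implicit Types x y z : SD.

Definition sd_mul x y : SD := (x.1 * shift x.2 y.1, x.2 * y.2).
Definition sd_one : SD := (1, 1).
Definition sd_inv x : SD := (shift x.2^-1 x.1^-1, x.2^-1).

Fact sd_mulA : associative sd_mul.
Proof.
by move=> [f a] [g b] [h c]; rewrite /sd_mul /= gmulfM shiftM !mulgA.
Qed.

Fact sd_mul1 : left_id sd_one sd_mul.
Proof. by move=> [f a]; rewrite /sd_mul /= shift1 !mul1g. Qed.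

Fact sd_1mul : right_id sd_one sd_mul.
Proof. by move=> [f a]; rewrite /sd_mul /= mult1 !mulg1. Qed.

Fact sd_mulV : left_inverse sd_one sd_inv sd_mul.
Proof. by move=> [f a]; rewrite /sd_mul /= -gmulfM !mulVg mult1. Qed.

Fact sd_Vmul : right_inverse sd_one sd_inv sd_mul.
Proof. by move=> [f a]; rewrite /sd_mul /= -shiftM !mulgV shift1 mulgV. Qed.

HB.instance Definition _ := isGroup.Build SD
  sd_mulA sd_mul1 sd_1mul sd_mulV sd_Vmul.

Lemma sdM x y : x * y = sd_mul x y. Proof. by []. Qed.

End Semidirect.

Lemma conj_commute (G : groupType) (x y : G) : commute x y -> x ^ y = x.
Proof. by move=> cxy; rewrite /conjg cxy mulKg. Qed.

Section Cocycle.
Variables (Gamma : sgraph) (S : set Gamma) (v : Gamma).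
Hypothesis Sv : S v.
Local Notation G := (raag Gamma).
Local Notation v_ := (@raag_gen Gamma).
Local Notation FX := (free_group (subsets G)).

Definition parabolic (T : set Gamma) : set G := gen (v_ @` T).
Definition rest : set G := parabolic [set u | S u /\ u <> v].
Definition link : set G := parabolic [set u | S u /\ edge v u].

Lemma parabolic_gen (T : set Gamma) u : T u -> parabolic T (v_ u).
Proof. by move=> Tu; apply: sub_gen; exists u. Qed.

Lemma parabolicP T : is_subgroup (parabolic T).
Proof. exact: gen_subgroup. Qed.

Lemma parabolic1 T : parabolic T 1.
Proof. by case: (parabolicP T). Qed.

Lemma restP : is_subgroup rest.
Proof. exact: parabolicP. Qed.

Lemma linkP : is_subgroup link.
Proof. exact: parabolicP. Qed.

Lemma link_commute x : link x -> commute (v_ v) x.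
Proof.
by apply: commute_gen => _ [u [_ vu] <-]; apply: raag_edge_commute.
Qed.

(* The parabolic subgroup on [S] is an HNN extension with stable letter [v].
   Killing [v] therefore splits it as a semidirect product of the parabolic
   subgroup on S - v with a free group on the cosets of the link; [coc] and
   [ret] below are the two components, and [unsplit] maps the free factor back. *)
Lemma split_morph_exists : exists h : {multiplicative G -> semidirect G},
  [/\ h (v_ v) = (fgen link, 1), forall u, S u -> u <> v -> h (v_ u) = (1, v_ u)
    & forall u, ~ S u -> h (v_ u) = 1].
Proof.
pose q u : semidirect G :=
  if u == v then (fgen link, 1) else if `[< S u >] then (1, v_ u) else 1.
have vE w : edge v w -> commute (q v) (q w).
  move=> vw; rewrite /q eqxx; case: eqP => [wv|_]; first by rewrite wv edge_irr in vw.
  case: asboolP => Sw; last exact: commute1.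
  rewrite /commute !sdM /sd_mul /= !mult1 !mulg1 !mul1g shift_gen.
  rewrite (translate_subgroup _ _).2 //; first exact: gen_subgroup.
  exact: parabolic_gen.
have [|h hE] := @raag_lift Gamma (semidirect G) q.
  move=> u w; case: (eqVneq u v) => [->|uv]; first exact: vE.
  case: (eqVneq w v) => [->|wv] uw.
    by apply: commute_sym; apply: vE; rewrite edge_sym.
  rewrite /q (negbTE uv) (negbTE wv).
  case: asboolP => Su; last exact: commute_sym (commute1 _).
  case: asboolP => Sw; last exact: commute1.
  rewrite /commute !sdM /sd_mul /= !mult1 !mulg1; congr (_, _).
  exact: raag_edge_commute.
exists h; split.
- by rewrite hE /q eqxx.
- by move=> u Su /eqP/negbTE uv; rewrite hE /q uv (asboolT Su).
- move=> u Su; rewrite hE /q; case: eqP => [uv|_]; first by case: Su; rewrite uv.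
  by rewrite (asboolF Su).
Qed.

Definition split_morph := projT1 (cid split_morph_exists).

Definition coc x : FX := (split_morph x).1.
Definition ret x : G := (split_morph x).2.

Lemma split_morphE :
  [/\ split_morph (v_ v) = (fgen link, 1),
      forall u, S u -> u <> v -> split_morph (v_ u) = (1, v_ u)
    & forall u, ~ S u -> split_morph (v_ u) = 1].
Proof. by rewrite /split_morph; case: cid. Qed.

Lemma cocM x y : coc (x * y) = coc x * shift (ret x) (coc y).
Proof. by rewrite /coc gmulfM. Qed.

Lemma retM : {morph ret : x y / x * y}.
Proof. by move=> x y; rewrite /ret gmulfM. Qed.

Lemma coc_v : coc (v_ v) = fgen link.
Proof. by case: split_morphE => E _ _; rewrite /coc E. Qed.

Lemma ret_v : ret (v_ v) = 1.
Proof. by case: split_morphE => E _ _; rewrite /ret E. Qed.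

Lemma coc1 : coc 1 = 1.
Proof. by rewrite /coc mult1. Qed.

Lemma ret1 : ret 1 = 1.
Proof. by rewrite /ret mult1. Qed.

Lemma retV x : ret x^-1 = (ret x)^-1.
Proof. by rewrite /ret multV. Qed.

Lemma cocV x : coc x^-1 = shift (ret x)^-1 (coc x)^-1.
Proof. by rewrite /coc multV. Qed.

Lemma split_rest x : rest x -> coc x = 1 /\ ret x = x.
Proof.
rewrite /coc /ret => rx; suff -> : split_morph x = (1, x) by [].
apply: (@gen_min _ _ [set x | split_morph x = (1, x) :> semidirect G]) rx; last first.
  by move=> _ [u [Su uv] <-]; case: split_morphE => _ E _; apply: E.
split=> /=; first by rewrite mult1.
- by move=> y z; rewrite gmulfM => -> ->; rewrite sdM /sd_mul /= mult1 mulg1.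
- move=> y; rewrite multV => ->.
  by rewrite -[_^-1]/(sd_inv _) /sd_inv /= invg1 mult1.
Qed.

Lemma ret_rest x : rest (ret x).
Proof.
apply: (@gen_min _ _ [set x | rest (ret x)] x _ _ (raag_generated x)).
  split=> /=; first by rewrite ret1; apply: parabolic1.
    by move=> y z ry rz; rewrite retM; apply: (subgroupM restP).
  by move=> y ry; rewrite retV; apply: (subgroupV restP).
move=> _ [u _ <-] /=; rewrite /ret; case: split_morphE => Ev ES EN.
have [->|/eqP uv] := eqVneq u v; first by rewrite Ev; apply: parabolic1.
case: (pselect (S u)) => Su; first by rewrite ES //; apply: parabolic_gen.
by rewrite EN //; apply: parabolic1.
Qed.

Definition letters : set (set G) := [set A | exists2 b, rest b & A = translate b link].

Lemma shift_letters b f : rest b ->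
  gen ((@fgen _) @` letters) f -> gen ((@fgen _) @` letters) (shift b f).
Proof.
move=> rb; apply: gen_morph => _ [_ [c rc ->] <-]; rewrite shift_gen -translateM.
apply: sub_gen; exists (translate (b * c) link) => //; exists (b * c) => //.
exact: (subgroupM restP).
Qed.

Lemma coc_letters x : gen ((@fgen _) @` letters) (coc x).
Proof.
set L := _ @` letters.
apply: (@gen_min _ _ [set x | gen L (coc x)] x _ _ (raag_generated x)).
  split=> /=; first by rewrite coc1; apply: gen1.
    move=> y z ly lz; rewrite cocM; apply: genM => //.
    by apply: shift_letters => //; apply: ret_rest.
  move=> y ly; rewrite cocV -retV; apply: shift_letters; first exact: ret_rest.
  exact: genV.
move=> _ [u _ <-] /=; rewrite /coc; case: split_morphE => Ev ES EN.
have [->|/eqP uv] := eqVneq u v.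
  rewrite Ev /=; apply: sub_gen; exists link => //; exists 1; first exact: parabolic1.
  by rewrite translate1.
case: (pselect (S u)) => Su; first by rewrite ES //; apply: gen1.
by rewrite EN //; apply: gen1.
Qed.

(** The coset of [b] goes to b v b^-1. The chosen representative does not matter because the link
    commutes with [v]; sets that are not translates of the link get the value 1. *)
Definition letter_elt (A : set G) : G :=
  if pselect (exists b, A = translate b link) is left e
  then v_ v ^ (projT1 (cid e))^-1 else 1.

Lemma letter_elt_translate b : letter_elt (translate b link) = v_ v ^ b^-1.
Proof.
rewrite /letter_elt; case: pselect => [e|[]]; last by exists b.
case: cid => c /= /translate_eq lk.
have /link_commute : link (b^-1 * c) by apply: lk; apply: linkP.
move=> /commuteV /conj_commute cE.
have -> : c^-1 = (b^-1 * c)^-1 * b^-1 by rewrite groupVM groupVK mulgK.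
by rewrite conjgM cE.
Qed.

Lemma letter_elt_shift b A : letters A ->
  letter_elt (translate b A) = letter_elt A ^ b^-1.
Proof.
move=> [c rc ->]; rewrite -translateM !letter_elt_translate groupVM.
by rewrite conjgM.
Qed.

Definition unsplit : {multiplicative FX -> G} := projT1 (cid (free_lift_gen letter_elt)).

Lemma unsplit_gen A : unsplit (fgen A) = letter_elt A.
Proof. by rewrite /unsplit; case: cid. Qed.

Lemma unsplit_shift b f : gen ((@fgen _) @` letters) f ->
  unsplit (shift b f) = unsplit f ^ b^-1.
Proof.
have [h hE] := @multiplicative_of G G (fun x => x ^ b^-1) (fun x y => conjMg x y b^-1).
move=> Lf; rewrite -hE.
have : (unsplit \o shift b : {multiplicative _ -> _}) f =
       (h \o unsplit : {multiplicative _ -> _}) f.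
  apply: eq_on_gen Lf => _ [A lA <-] /=.
  by rewrite shift_gen !unsplit_gen hE letter_elt_shift.
exact.
Qed.

(** The right-hand side is multiplicative in [x], since [unsplit] turns shifts into conjugations,
    and it agrees with the identity on the vertices in [S]. Hence nothing of the parabolic subgroup
    is lost in the semidirect product. *)
Lemma unsplitK x : parabolic S x -> x = unsplit (coc x) * ret x.
Proof.
have E1 : unsplit (coc 1) * ret 1 = 1 by rewrite coc1 ret1 mult1 mulg1.
have EM y z : unsplit (coc (y * z)) * ret (y * z) =
    (unsplit (coc y) * ret y) * (unsplit (coc z) * ret z).
  rewrite cocM retM gmulfM unsplit_shift; last exact: coc_letters.
  by rewrite /conjg groupVK !mulgA mulgVK.
apply: (@gen_min _ _ [set x | x = unsplit (coc x) * ret x]).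
  split=> /=; first by rewrite E1.
    by move=> y z yE zE; rewrite EM -yE -zE.
  move=> y yE; apply: (mulgI y); rewrite mulgV {1}yE -EM mulgV E1 //.
move=> _ [u Su <-] /=; rewrite /coc /ret; case: split_morphE => Ev ES EN.
have [->|/eqP uv] := eqVneq u v; last by rewrite ES //= mult1 mul1g.
rewrite Ev /= mulg1 unsplit_gen -(translate1 link) letter_elt_translate.
by rewrite invg1 conjg1.
Qed.

Lemma coc_eq1 x : parabolic S x -> coc x = 1 -> rest x.
Proof.
by move=> Sx cx; rewrite (unsplitK Sx) cx mult1 mul1g; apply: ret_rest.
Qed.

Lemma letters_nform f a : gen ((@fgen _) @` letters) f -> a \in nform f -> letters a.1.
Proof.
move=> Lf; suff [w wL ->] : exists2 w, (forall a, a \in w -> letters a.1) & f = of_word w.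
  by rewrite nform_of_word => /nf_letters; apply: wL.
elim/gen_ind_r: f / Lf => [|_ _ [w wL ->] [A lA <-]|_ _ [w wL ->] [A lA <-]].
- by exists [::].
- exists (rcons w (A, false)); last by rewrite -cats1 of_wordM.
  by move=> b; rewrite mem_rcons inE => /orP[/eqP -> //|]; apply: wL.
- exists (rcons w (A, true)); last by rewrite -cats1 of_wordM of_word1.
  by move=> b; rewrite mem_rcons inE => /orP[/eqP -> //|]; apply: wL.
Qed.

Lemma coc_nform x a : a \in nform (coc x) -> letters a.1.
Proof. by apply: letters_nform; apply: coc_letters. Qed.

(** Conjugation by such an element removes the letter [a] from the front of a cocycle value; cyclic
    reduction rests on this. *)
Lemma letter_realized a : letters a.1 ->
  exists x, [/\ parabolic S x, coc x = of_word [:: a] & ret x = 1].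
Proof.
case: a => A e [b rb /= ->]; pose y := b * (v_ v * b^-1).
have [cb rb'] := split_rest rb.
have cVb : coc b^-1 = 1 by rewrite cocV cb invg1 mult1.
have ry : ret y = 1 by rewrite !retM ret_v retV mul1g mulgV.
have cy : coc y = fgen (translate b link).
  rewrite !cocM coc_v ret_v cb cVb mult1 mulg1 mul1g rb'.
  exact: shift_gen.
have Sy : parabolic S y.
  have Sb : parabolic S b.
    by apply: gen_mono rb => _ [u [Su _] <-]; exists u.
  apply: (subgroupM (parabolicP _)) => //.
  apply: (subgroupM (parabolicP _)); first exact: parabolic_gen.
  exact: (subgroupV (parabolicP _)).
case: e; last by exists y; rewrite of_word1.
exists y^-1; split; first exact: (subgroupV (parabolicP _)).
  by rewrite cocV ry cy of_word1 invg1 shift1.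
by rewrite retV ry invg1.
Qed.

End Cocycle.

(** * Centralizers *)

Section VertexCentralizer.
Variables (Gamma : sgraph) (v : Gamma).
Local Notation G := (raag Gamma).
Local Notation v_ := (@raag_gen Gamma).

(** Apply the cocycle, with [S] consisting of all vertices, to the commutation. Exponent sums of the
    letter [L] show that [ret g] fixes this letter, hence lies in the link. Then [coc g] centralizes
    a power of a free generator and is itself a power of it. *)
Lemma commute_vertex_power (g : G) n : (0 < n)%N -> commute g (v_ v ^+ n) ->
  exists a h, [/\ gen [set v_ v] a, parabolic [set u | edge v u] h & g = a * h].
Proof.
move=> n0 cg; have Tv : [set: Gamma] v by [].
set L := link [set: Gamma] v.
have cvn : coc Tv (v_ v ^+ n) = fgen L ^+ n /\ ret Tv (v_ v ^+ n) = 1.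
  elim: (n) => [|k [IHc IHr]]; first by rewrite !expg0 coc1 ret1.
  by rewrite !expgS cocM retM coc_v ret_v IHc IHr shift1 mulg1.
have := congr1 (coc Tv) cg; rewrite !cocM cvn.1 cvn.2 shift1 multX shift_gen => cE.
have [h hE] := free_lift_gen (fun A : set G => ((A == L)%:Z, 0, 0)%R : heis).
have bL : translate (ret Tv g) L = L.
  have fM : additive_to_int (fun f => (h f).1.1) by move=> x y; rewrite gmulfM.
  have := congr1 (fun f => (h f).1.1) cE.
  rewrite !fM !(additiveX fM) !hE /= eqxx; case: eqP => // _; lia.
have rL : L (ret Tv g) by apply/translate_subgroup => //; apply: linkP.
exists (unsplit [set: Gamma] v (coc Tv g)), (ret Tv g); split.
- move: cE; rewrite bL => /(free_commute_gen_pow n0).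
  apply: gen_morph => _ ->; rewrite unsplit_gen /L -(translate1 (link _ _)).
  by rewrite letter_elt_translate invg1 conjg1; apply: sub_gen.
- by apply: gen_mono rL => _ [u [_ vu] <-]; exists u.
- apply: unsplitK; apply: gen_mono (raag_generated g) => _ [u _ <-].
  by exists u.
Qed.

Lemma commute_vertex_powerE (g : G) n : (0 < n)%N -> commute g (v_ v ^+ n) ->
  commute g (v_ v).
Proof.
move=> n0 /(commute_vertex_power n0)[a [h [ga gh ->]]].
apply: commute_sym; apply: commuteM.
  by apply: commute_gen ga => _ ->.
by apply: commute_gen gh => _ [u vu <-]; apply: raag_edge_commute.
Qed.

End VertexCentralizer.

Section TreeAction.
Variables (Gamma : sgraph) (S : set Gamma) (v : Gamma).
Hypothesis Sv : S v.
Local Notation G := (raag Gamma).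
Local Notation v_ := (@raag_gen Gamma).
Local Notation FX := (free_group (subsets G)).
Local Notation lk := (link S v).
Local Notation coc := (coc Sv).
Local Notation ret := (ret Sv).
Local Notation tr b := (map_word (@translate G b)).

(* The vertices of the Bass-Serre tree of the splitting are identified with
   the elements of the free factor. *)
Definition tact (y : G) (f : FX) : FX := coc y * shift (ret y) f.

Lemma tactM x y f : tact (x * y) f = tact x (tact y f).
Proof. by rewrite /tact cocM retM shiftM gmulfM mulgA. Qed.

Lemma tact_1 f : tact 1 f = f.
Proof. by rewrite /tact coc1 ret1 shift1 mul1g. Qed.

Lemma tact_coc x y : tact x (coc y) = coc (x * y).
Proof. by rewrite cocM. Qed.

Lemma shift_of_word b w : shift b (of_word w) = of_word (tr b w).
Proof.
elim: w => [|[A e] w IHw] /=; first exact: mult1.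
rewrite (of_word_cons (A, e)) gmulfM IHw (of_word_cons (translate b A, e)).
by rewrite !of_word1; case: e; rewrite ?multV shift_gen.
Qed.

Lemma size_map_word (s : set G -> set G) w : size (map_word s w) = size w.
Proof. exact: size_map. Qed.

Lemma take_map_word (s : set G -> set G) n w :
  take n (map_word s w) = map_word s (take n w).
Proof. by rewrite /map_word map_take. Qed.

Lemma tr_reduced b w : reduced w -> reduced (tr b w).
Proof. by apply: map_word_reduced; apply: translate_inj. Qed.

Lemma reduced_glue (X : choiceType) (u w r : seq (X * bool)) : w != [::] ->
  reduced (u ++ w) -> reduced (w ++ r) -> reduced (u ++ w ++ r).
Proof.
case: w => // a w _ ruw rwr.
apply: (@reduced_cat _ _ _ a) => //; first exact: reduced_catl ruw.
case: (eqVneq u [::]) => [->|u0]; [by left|right; right].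
by have := reduced_junction a ruw u0 isT.
Qed.

Section Hyperbolic.
Variable x : G.
Local Notation F := (nform (coc x)).
Local Notation b := (ret x).
Hypothesis F0 : F != [::].
Hypothesis rF : reduced (F ++ tr b F).
Local Notation L := (size F).

Let L0 : (0 < L)%N. Proof. by rewrite lt0n size_eq0. Qed.

(** By [rF] the translates of [F] follow one another without cancellation, so these words are
    prefixes of a single infinite ray, one half of the axis of [x]. *)
Definition axis N := nform (coc (x ^+ N)).

Lemma axisS N : axis N.+1 = F ++ tr b (axis N).
Proof.
have step N' : reduced (F ++ tr b (axis N')) -> axis N'.+1 = F ++ tr b (axis N').
  move=> r; rewrite {1}/axis expgS -tact_coc /tact.
  rewrite -{1}(of_nform (coc x)) -(of_nform (coc (x ^+ N'))) shift_of_word.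
  by rewrite -of_wordM nform_reducedE.
apply: (step N); elim: N => [|N IHN].
  by rewrite /axis expg0 coc1 nform1 cats0 nform_reduced.
rewrite step //.
rewrite /map_word map_cat; apply: reduced_glue => //.
  by case: (F) F0.
rewrite -map_cat; apply: tr_reduced; exact: IHN.
Qed.

Lemma size_axis N : size (axis N) = (N * L)%N.
Proof.
elim: N => [|N IHN]; first by rewrite /axis expg0 coc1 nform1.
by rewrite axisS size_cat size_map_word IHN mulSn.
Qed.

Lemma axis_prefix N M : exists r, axis (N + M) = axis N ++ r.
Proof.
elim: N => [|N [r IHN]]; first by exists (axis M); rewrite /axis expg0 coc1 nform1.
exists (tr b r); rewrite addSn !axisS IHN /map_word map_cat catA //.
Qed.

(** [axis n] has length [n * L], which is at least [n]; this is the prefix of length exactly [n]. *)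
Definition ray n := take n (axis n).

Lemma rayE n N : (n <= N * L)%N -> take n (axis N) = ray n.
Proof.
move=> nN; have [r rE] := axis_prefix N n; have [r' rE'] := axis_prefix n N.
have -> : take n (axis N) = take n (axis (N + n)).
  by rewrite rE takel_cat // size_axis.
by rewrite addnC rE' takel_cat // size_axis leq_pmulr.
Qed.

Lemma size_ray n : size (ray n) = n.
Proof. by rewrite size_takel // size_axis leq_pmulr. Qed.

Lemma take_ray n m : (n <= m)%N -> take n (ray m) = ray n.
Proof.
by move=> nm; rewrite /ray take_takel // rayE // (leq_trans nm) // leq_pmulr.
Qed.

Lemma tact_ray n : tact x (of_word (ray n)) = of_word (ray (L + n)).
Proof.
rewrite /tact -(of_nform (coc x)) shift_of_word -of_wordM; congr of_word.
rewrite of_nform -(@rayE (L + n) n.+1); last first.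
  by rewrite mulSn leq_add2l leq_pmulr.
by rewrite axisS take_cat ltnNge leq_addr /= addKn take_map_word.
Qed.

Lemma tact_ray_pow j n : tact (x ^+ j) (of_word (ray n)) = of_word (ray (j * L + n)).
Proof.
elim: j => [|j IHj]; first by rewrite expg0 tact_1.
by rewrite expgS tactM IHj tact_ray mulSn addnA.
Qed.

(* An element commuting with [x] translates the axis of [x], hence shifts the ray. *)
Lemma tact_commute_ray y : commute x y ->
  exists p q, forall n, tact y (of_word (ray (n + p))) = of_word (ray (n + q)).
Proof.
(* With this [N0] the axis word is longer than anything [g] can cancel, so [w] below is nonempty. *)
move=> cxy; set g := nform (coc y); set be := ret y; pose N0 := (size g).+1.
have rW N : reduced (tr be (axis N)) by apply/tr_reduced/nform_reduced.
have [g1 [c [w [gE WE rgw]]]] := cancellation (nform_reduced (coc y)) (rW N0).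
have szg : (size g1 + size c)%N = size g by rewrite -size_cat -gE.
have szW : (size c + size w = N0 * L)%N.
  by rewrite -(size_word_inv c) -size_cat -WE size_map_word size_axis.
have N0L : (N0 <= N0 * L)%N by rewrite leq_pmulr.
have w0 : w != [::] by rewrite -size_eq0; move: (erefl N0) szg szW N0L; rewrite {1}/N0 /=; lia.
exists (size c), (size g1) => n.
set D := drop (size c) (tr be (ray (n + size c))).
have DE : tr be (ray (n + size c)) = word_inv c ++ D.
  rewrite -{1}(cat_take_drop (size c) (tr be _)); congr (_ ++ _).
  rewrite take_map_word take_ray ?leq_addl // -(@rayE _ N0); last by lia.
  by rewrite -take_map_word WE -(size_word_inv c) take_size_cat.
have -> : tact y (of_word (ray (n + size c))) = of_word (g1 ++ D).
  by rewrite /tact shift_of_word DE -(of_nform (coc y)) gE of_word_catV.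
(* In x^N y at most [size g] letters of [axis N] are cancelled. The choice of [N] puts them beyond
   position [n + size g1], so equality with y x^N identifies the prefixes up to there. *)
congr of_word; pose N := (N0 + (n + size g + size g))%N.
have NL : (N <= N * L)%N by rewrite leq_pmulr.
have [r rE] := axis_prefix N0 (n + size g + size g).
have trN : tr be (axis N) = word_inv c ++ (w ++ tr be r).
  by rewrite /N rE /map_word map_cat -!/(map_word _ _) WE catA.
have yN : nform (coc (y * x ^+ N)) = g1 ++ w ++ tr be r.
  rewrite -tact_coc /tact -(of_nform (coc (x ^+ N))) shift_of_word.
  rewrite -/(axis N) trN -(of_nform (coc y)) gE of_word_catV.
  rewrite nform_reducedE //; apply: reduced_glue => //.
  by apply: (@reduced_catr _ (word_inv c)); rewrite -trN.
have Nx : nform (coc (x ^+ N * y)) = g1 ++ w ++ tr be r.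
  by rewrite -yN; congr (nform (coc _)); apply/commute_sym/commuteX/commute_sym.
have rg : reduced (tr (ret (x ^+ N)) g) by apply/tr_reduced/nform_reduced.
have [u1 [c' [v1 [AE gE' ru]]]] := cancellation (nform_reduced (coc (x ^+ N))) rg.
have {Nx} uE : u1 ++ v1 = g1 ++ w ++ tr be r.
  rewrite -Nx -tact_coc /tact -(of_nform (coc (x ^+ N))) AE.
  by rewrite -(of_nform (coc y)) shift_of_word -/g gE' of_word_catV nform_reducedE.
have szc' : (size c' <= size g)%N.
  by rewrite -(size_map_word (translate (ret (x ^+ N))) g) gE' size_cat size_word_inv leq_addr.
have szu : (size u1 + size c' = N * L)%N by rewrite -size_cat -AE -size_axis.
have nu : (n + size g1 <= size u1)%N by rewrite /N in NL szu *; lia.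
have -> : ray (n + size g1) = take (n + size g1) (u1 ++ v1).
  rewrite takel_cat // -(@rayE _ N); last by lia.
  by rewrite /axis AE takel_cat.
rewrite uE take_cat ltnNge leq_addl /= addnK; congr (_ ++ _).
have -> : w ++ tr be r = drop (size c) (tr be (axis N)).
  by rewrite trN -(size_word_inv c) drop_size_cat.
by rewrite /D -(@rayE _ N) ?take_drop ?take_map_word //; rewrite /N in NL *; lia.
Qed.

Hypothesis lk_faithful : forall h : G, lk h ->
  (forall f : G -> int, additive_to_int f -> f h = 0%R) -> h = 1.

Lemma hyperbolic_centralizer_abelian y z : parabolic S y -> parabolic S z ->
  commute x y -> commute x z -> commute y z.
Proof.
move=> Sy Sz cxy cxz.
have [p [q yR]] := tact_commute_ray cxy; have [p' [q' zR]] := tact_commute_ray cxz.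
pose k := (z * y)^-1 * (y * z).
have kR n : tact k (of_word (ray (n + p + p'))) = of_word (ray (n + p + p')).
  have -> : tact k (of_word (ray (n + p + p'))) =
      tact (z * y)^-1 (tact (z * y) (of_word (ray (n + p + p')))).
    rewrite /k (tactM (z * y)^-1); congr (tact (z * y)^-1 _).
    rewrite !tactM zR (_ : (n + p + q' = n + q' + p)%N); last by lia.
    rewrite yR (_ : (n + p + p' = n + p' + p)%N); last by lia.
    rewrite yR (_ : (n + p' + q = n + q + p')%N); last by lia.
    by rewrite zR; congr (of_word (ray _)); lia.
  by rewrite -tactM mulVg tact_1.
have cxk : commute x k.
  by apply: commuteM; [apply: commuteV|]; apply: commuteM.
(* [k] commutes with x^m, which pushes the ray past its first p + p' letters, into the range where
   [k] is already known to act trivially. *)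
have kray i : tact k (of_word (ray i)) = of_word (ray i).
  pose m := (p + p')%N; have cm : commute (x ^+ m) k by apply/commute_sym/commuteX/commute_sym.
  have kE : k = x ^- m * (k * x ^+ m) by rewrite -cm mulKg.
  have mL : (m <= m * L)%N by rewrite leq_pmulr.
  have jE : (m * L + i = (m * L + i - m) + p + p')%N by rewrite /m in mL *; lia.
  have xi : of_word (ray i) = tact (x ^- m) (of_word (ray (m * L + i))).
    by rewrite -tact_ray_pow -tactM mulVg tact_1.
  by rewrite {1}kE (tactM (x ^- m)) (tactM k) tact_ray_pow jE kR -jE -xi.
have ck : coc k = 1.
  by have := kray 0%N; rewrite /ray take0 /tact -[of_word _]/(1 : FX) mult1 mulg1.
have Sk : parabolic S k.
  apply: (subgroupM (parabolicP _)); last exact: (subgroupM (parabolicP _)).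
  by apply: (subgroupV (parabolicP _)); apply: (subgroupM (parabolicP _)).
have [_ rk] := split_rest Sv (coc_eq1 Sk ck).
(* The first letter of the ray is the first edge: a coset of the link whose stabilizer in the
   subgroup fixing the base vertex is a conjugate of the link. *)
have [a aE] : exists a, ray 1 = [:: a].
  by have := size_ray 1; case: (ray 1) => // a [|//] _; exists a.
have [bb rb aL] : letters S v a.1.
  apply: (@coc_nform _ _ _ Sv x).
  suff : a \in ray 1 by rewrite /ray /axis expg1 => /mem_take.
  by rewrite aE mem_head.
have := kray 1%N; rewrite aE /tact ck mul1g shift_of_word rk.
move=> /(congr1 (@nform _)); rewrite !nform_reducedE //=.
move=> /(congr1 (head a)) /(congr1 fst) /=; rewrite aL -translateM.
move=> /esym/(translate_eq bb (k * bb) (linkP S v)) lkk.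
have k1 : bb^-1 * (k * bb) = 1.
  apply: lk_faithful => // f fM.
  by rewrite -/(conjg k bb) additiveJ // /k fM additiveV // !fM; lia.
have : k = 1 by rewrite -[k](conjgK bb) [k ^ bb]k1 conj1g.
by move=> /(congr1 ( *%g (z * y))); rewrite /k mulVKg mulg1.
Qed.

End Hyperbolic.

(** [x] fixes the vertex [coc y] and acts by relabelling letters. A first letter of [coc y] would be
    a coset fixed by [x], putting a conjugate of [x] into the link. *)
Lemma elliptic_centralizer x : rest S v x -> (forall g, ~ lk (x ^ g)) ->
  forall y, parabolic S y -> commute x y -> rest S v y.
Proof.
move=> rx nlk y Sy cxy; apply: (coc_eq1 (Sv := Sv) Sy).
have [cx rxx] := split_rest Sv rx.
have := congr1 coc cxy; rewrite !cocM cx mul1g rxx mult1 mulg1.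
move=> /(congr1 (@nform _)); rewrite nform_shift => fixed.
case E: (nform (coc y)) => [|a w] in fixed; first exact: nform_eq0.
have [b rb aL] : letters S v a.1.
  by apply: (@coc_nform _ _ _ Sv y); rewrite E mem_head.
have := congr1 (head a) fixed; move=> /(congr1 fst) /=; rewrite aL -translateM.
by move=> /esym/(translate_eq b (x * b) (linkP S v)) /(nlk b).
Qed.

(** Cyclic reduction twisted by [ret x]: if the word meets its translate with a cancellation,
    conjugating by an element that realizes the first letter strips one letter at each end. *)
Lemma conj_cyclically_reduced x : parabolic S x -> exists g, parabolic S g /\
  (coc (x ^ g) = 1 \/ nform (coc (x ^ g)) != [::] /\
     reduced (nform (coc (x ^ g)) ++ tr (ret (x ^ g)) (nform (coc (x ^ g))))).
Proof.
have [n] := ubnP (size (nform (coc x))).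
elim: n x => // n IHn x; rewrite ltnS => szx Sx.
case E: (nform (coc x)) => [|e u] in szx.
  exists 1; split; first exact: parabolic1.
  by left; rewrite conjg1; apply: nform_eq0.
have rx : reduced (e :: u) by rewrite -E nform_reduced.
case: (boolP (reduced ((e :: u) ++ tr (ret x) (e :: u)))) => [r|nr].
  exists 1; split; first exact: parabolic1.
  by right; rewrite conjg1 E.
have eL : letters S v e.1.
  by apply: (@coc_nform _ _ _ Sv x); rewrite E mem_head.
case/lastP: u => [|u z] in E szx rx nr.
  (* A single letter always passes the test: translation keeps its sign, and inverse letters have
     opposite signs. *)
  case/negP: nr; case: (e) => A d /=; rewrite /reduced /= andbT.
  by apply/eqP => -[_]; case: d.
have zE : (translate (ret x) e.1, e.2) = linv z.
  apply/eqP; apply: contraNT nr => nz; apply: (@reduced_cat _ _ _ e) => //.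
    exact: tr_reduced.
  by right; right; rewrite /= last_rcons.
have [y [Sy cy ry]] := letter_realized Sv eL.
have cxy : coc (x ^ y) = of_word u.
  rewrite /conjg !cocM cocV ry invg1 !shift1 cy shift_of_word /= zE.
  rewrite retV ry invg1 shift1 -(of_nform (coc x)) E of_word_cons -cats1 of_wordM.
  by rewrite of_word_linv !mulgA mulVg mul1g mulgK.
have Sxy : parabolic S (x ^ y) by exact: (subgroupJ (parabolicP _)).
have ru : reduced u.
  by move: (reduced_tail rx); rewrite -cats1 => /reduced_catl.
have [|g [Sg gE]] := IHn (x ^ y) _ Sxy.
  rewrite cxy nform_reducedE //; move: szx; rewrite /= size_rcons; exact: ltnW.
exists (y * g); split; first exact: (subgroupM (parabolicP _)).
by rewrite conjgM.
Qed.

Hypothesis lk_faithful : forall h : G, lk h ->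
  (forall f : G -> int, additive_to_int f -> f h = 0%R) -> h = 1.

Definition abelian_centralizer (A : set G) x := forall y z : G, A y -> A z ->
  commute x y -> commute x z -> commute y z.

(** [P] will be conjugacy into the cyclic group of a vertex. The step needs only that it passes from
    conjugates to [x] and holds on the link. *)
Lemma centralizer_step (P : G -> Prop) :
  (forall x g, P (x ^ g) -> P x) -> (forall x, lk x -> P x) ->
  (forall x, rest S v x -> P x \/ abelian_centralizer (rest S v) x) ->
  forall x, parabolic S x -> P x \/ abelian_centralizer (parabolic S) x.
Proof.
move=> PJ Plk IH x Sx; have [g [Sg xg]] := conj_cyclically_reduced Sx.
have Sxg : parabolic S (x ^ g) by exact: (subgroupJ (parabolicP _)).
suff [Pxg|ab] : P (x ^ g) \/ abelian_centralizer (parabolic S) (x ^ g).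
- by left; apply: PJ Pxg.
- right=> y z Sy Sz cxy cxz; rewrite -(conjgK g y) -(conjgK g z).
  apply: commuteJ; apply: ab; try exact: commuteJ.
    by exact: (subgroupJ (parabolicP _)).
  by exact: (subgroupJ (parabolicP _)).
case: xg => [cx|[F0 rF]]; last first.
  right=> y z Sy Sz; exact: (hyperbolic_centralizer_abelian F0 rF lk_faithful Sy Sz).
have rx := coc_eq1 Sxg cx.
have [[h lh]|nlk] := pselect (exists h, lk ((x ^ g) ^ h)).
  by left; apply: (PJ _ h); apply: Plk.
case: (IH _ rx) => [|ab]; [by left|right=> y z Sy Sz cxy cxz].
have nlk' h : ~ lk ((x ^ g) ^ h) by move=> lh; apply: nlk; exists h.
by apply: ab => //; apply: (elliptic_centralizer rx).
Qed.

End TreeAction.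

(** * Inner pearls *)

Section Vertices.
Variable Gamma : sgraph.
Local Notation G := (raag Gamma).
Local Notation v_ := (@raag_gen Gamma).

Lemma vertex_count u : exists f : G -> int, additive_to_int f /\
  forall w, f (v_ w) = Posz (w == u).
Proof. exact: (raag_additive (fun w => Posz (w == u))). Qed.

Lemma gen_vertex_faithful u x : gen [set v_ u] x ->
  (forall f : G -> int, additive_to_int f -> f x = 0%R) -> x = 1.
Proof.
move=> /gen1P[n xE] fx; have [f [fM fE]] := vertex_count u.
have := fx f fM; case: xE => ->; rewrite ?additiveV // additiveX // fE eqxx.
  by case: n => // n; lia.
by case: n => [|n]; rewrite ?expg0 ?invg1 //; lia.
Qed.

Lemma parabolicT x : parabolic [set: Gamma] x.
Proof. by apply: gen_mono (raag_generated x) => _ [u _ <-]; exists u. Qed.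

Lemma parabolic_mono (S T : set Gamma) : S `<=` T ->
  @parabolic Gamma S `<=` @parabolic Gamma T.
Proof. by move=> ST; apply: gen_mono => _ [u Su <-]; exists u => //; apply: ST. Qed.

Definition conj_pm (y x : G) := exists g, x = y ^ g \/ x = y^-1 ^ g.

Section Inner.
Hypothesis power_or_abelian : forall x : G,
  (exists g u, gen [set v_ u] (x ^ g)) \/
  (forall y z, commute x y -> commute x z -> commute y z).

(** A positive power of a vertex has the centralizer of the vertex. So if [x] is conjugate to a
    power of [v_ u], the corresponding conjugate of [v_ u] lies in the center of C(x), which is
    generated by [x]; exponent sums then make the exponent 1 or -1. *)
Lemma inner_pearl_conj x : inner_pearl x ->
  exists2 u, conj_pm (v_ u) x & ~ is_abelian (centralizer (v_ u)).
Proof.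
move=> [x1 nab xc].
have [[g [u gx]]|ab] := power_or_abelian x; last first.
  by case: nab => y z; apply: ab.
have [f [fM fE]] := vertex_count u.
have xg1 : x ^ g <> 1 by move=> /eqP; rewrite conjg_eq1 => /eqP.
have [n n0 xgE] : exists2 n, (0 < n)%N & x ^ g = v_ u ^+ n \/ x ^ g = v_ u ^- n.
  have [[|n] xgE] := gen1P gx; last by exists n.+1.
  by case: xg1; case: xgE => ->; rewrite ?expg0 ?invg1.
have cv y : commute x y -> commute (v_ u ^ g^-1) y.
  move=> cxy; rewrite -(conjgK g y); apply: commuteJ; apply: commute_sym.
  apply: (@commute_vertex_powerE _ u _ n) => //.
  have : commute (y ^ g) (x ^ g) by apply: commuteJ; apply: commute_sym.
  by case: xgE => -> // /commuteV; rewrite groupVK.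
have : center (centralizer x) (v_ u ^ g^-1).
  split; last by move=> y cxy; apply: cv.
  by rewrite /centralizer /=; apply: commute_sym; apply: cv.
rewrite -xc => /gen1P[l vE].
have fx : f x = Posz n \/ f x = (- Posz n)%R.
  rewrite -(additiveJ fM x g); case: xgE => ->; [left|right];
    by rewrite ?additiveV // additiveX // fE eqxx; lia.
have f1 : f (v_ u ^ g^-1) = 1%R by rewrite additiveJ // fE eqxx.
have n1 : n = 1%N.
  suff : (n * l)%N = 1%N by move=> /eqP; rewrite muln_eq1 => /andP[/eqP].
  by move: f1; case: vE => ->; rewrite ?additiveV // additiveX // -mulr_natr;
    case: fx => ->; lia.
have xE : x = (x ^ g) ^ g^-1 by rewrite conjgK.
exists u.
  by exists g^-1; rewrite n1 expg1 in xgE; case: xgE => <-; [left|right].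
move=> ab; apply: nab => y z cy cz; rewrite -(conjgK g y) -(conjgK g z).
apply: commuteJ; apply: ab; rewrite /centralizer /=.
  by have := commuteJ g (cv _ cy); rewrite conjgKV.
by have := commuteJ g (cv _ cz); rewrite conjgKV.
Qed.

End Inner.

Lemma centralizer_star u x : commute x (v_ u) ->
  gen (v_ @` [set w | w = u \/ edge u w]) x.
Proof.
move=> cx; have [a [h [ga gh ->]]] := @commute_vertex_power _ u x 1 isT cx.
apply: genM; first by apply: gen_mono ga => _ ->; exists u => //; left.
by apply: gen_mono gh => _ [w uw <-]; exists w => //; right.
Qed.

(** The star of [u] generates the centralizer, and a star with at most one neighbour is abelian. *)
Lemma nonabelian_centralizer_degree u : ~ is_abelian (centralizer (v_ u)) ->
  exists w1 w2 : Gamma, [/\ edge u w1, edge u w2 & w1 <> w2].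
Proof.
move=> nab; apply: contrapT => none; apply: nab => y z.
rewrite /centralizer /= => /commute_sym/centralizer_star gy /commute_sym/centralizer_star gz.
apply: commute_gen gz => _ [w uw <-]; apply: commute_sym.
apply: commute_gen gy => _ [w' uw' <-].
case: uw => [->|uw]; case: uw' => [->|uw'] //; try exact: raag_edge_commute.
  by apply: commute_sym; apply: raag_edge_commute.
suff -> : w = w' by [].
by apply: contrapT => ww'; apply: none; exists w, w'.
Qed.

(* The retraction onto the star of [u] fixes the centralizer of [u]. *)
Lemma conj_in_star u w x : commute x (v_ u) -> conj_pm (v_ w) x ->
  (w = u \/ edge u w) /\
  exists h, commute h (v_ u) /\ (x = v_ w ^ h \/ x = (v_ w)^-1 ^ h).
Proof.
move=> cx [g xE].
pose q (a : Gamma) : G := if (a == u) || edge u a then v_ a else 1.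
have [|r rE] := @raag_lift Gamma G q.
  move=> a b ab; rewrite /q; case: ifP => _; last exact: commute_sym (commute1 _).
  by case: ifP => _; [apply: raag_edge_commute|apply: commute1].
have rfix y : commute y (v_ u) -> r y = y.
  move=> /centralizer_star gy.
  apply: (@gen_min _ _ [set y | r y = y] y _ _ gy).
    split=> /=; first exact: mult1.
      by move=> a b ra rb; rewrite gmulfM ra rb.
    by move=> a ra; rewrite multV ra.
  by move=> _ [a [->|ua] <-] /=; rewrite rE /q ?eqxx // ua orbT.
have rc y : commute (r y) (v_ u).
  apply: commute_sym; have := raag_generated y.
  apply: (@gen_min _ _ [set y | commute (v_ u) (r y)]).
    split=> /=; first by rewrite mult1; apply: commute1.
      by move=> a b ra rb; rewrite gmulfM; apply: commuteM.
    by move=> a ra; rewrite multV; apply: commuteV.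
  move=> _ [a _ <-] /=; rewrite rE /q; case: eqP => [->|_] //=.
  by case: ifP => [ua|_]; [apply: raag_edge_commute|apply: commute1].
have xr : x = r (v_ w) ^ r g \/ x = (r (v_ w))^-1 ^ r g.
  by rewrite -(rfix x cx); case: xE => ->; rewrite multJ ?multV; [left|right].
case: (boolP ((w == u) || edge u w)) => star; last first.
  exfalso; have x1 : x = 1.
    by case: xr => ->; rewrite rE /q (negbTE star) ?invg1 conj1g.
  have [f [fM fE]] := vertex_count w.
  have : f x = 0%R by rewrite x1 additive1.
  by case: xE => ->; rewrite additiveJ // ?additiveV // fE eqxx.
split; first by case/orP: star => [/eqP|]; [left|right].
by exists (r g); split=> //; move: xr; rewrite rE /q star.
Qed.

(* The quotient of C(c) by <c> is the free group on [a] and [b]. *)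
Lemma neighbour_form (a b c : Gamma) (p : G) :
  edge c a -> edge c b -> a <> b -> ~~ edge a b ->
  (forall w, edge c w -> w = a \/ w = b) -> commute p (v_ c) ->
  gen [set p; v_ a; v_ c] (v_ b) ->
  exists A B D, [/\ gen [set v_ a] A, gen [set v_ a] B, gen [set v_ c] D &
    p = A * v_ b * B * D \/ p = A * (v_ b)^-1 * B * D].
Proof.
move=> ca cb /eqP ab nab cw cp gb.
have ac : (a == c) = false by apply/eqP => E; rewrite E edge_irr in ca.
have bc : (b == c) = false by apply/eqP => E; rewrite E edge_irr in cb.
pose q (w : Gamma) : free_group bool :=
  if w == a then fgen false else if w == b then fgen true else 1.
have [|r rE] := @raag_lift Gamma _ q.
  move=> u w uw; rewrite /q.
  case: (eqVneq u a) => [ua|_]; last first.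
    case: (eqVneq u b) => [ub|_]; last exact: commute_sym (commute1 _).
    case: (eqVneq w a) => [wa|_]; last by case: ifP => _; [apply: commute_refl|apply: commute1].
    by move: uw nab; rewrite ub wa edge_sym => ->.
  case: (eqVneq w a) => [_|_]; first exact: commute_refl.
  case: (eqVneq w b) => [wb|_]; last exact: commute1.
  by move: uw nab; rewrite ua wb => ->.
have [s sE] := free_lift_gen (fun i : bool => if i then v_ b else v_ a).
have [D [h [gD gh pE]]] := @commute_vertex_power _ c p 1 isT cp.
(* [s] splits [r] on the subgroup generated by [a] and [b], so the form found in the free group
   carries over to [h]. *)
have srh : s (r h) = h.
  apply: (@gen_min _ _ [set y | s (r y) = y] h _ _ gh).
    split=> /=; first by rewrite !mult1.
      by move=> y z yE zE; rewrite !gmulfM yE zE.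
    by move=> y yE; rewrite !multV yE.
  move=> _ [w /cw wab <-] /=; rewrite rE /q.
  case: wab => ->; rewrite ?eqxx ?sE //.
  by rewrite eq_sym (negbTE ab) sE.
have rc : r (v_ c) = 1 by rewrite rE /q eq_sym ac eq_sym bc.
have rp : r p = r h.
  rewrite pE gmulfM (_ : r D = 1) ?mul1g //.
  have := gD; apply: (@gen_min _ _ [set y | r y = 1]) => [|_ -> //].
  split=> /=; first exact: mult1.
    by move=> y z; rewrite gmulfM => -> ->; rewrite mulg1.
  by move=> y; rewrite multV => ->; rewrite invg1.
have : gen [set r h; fgen false] (fgen true).
  have <- : r (v_ b) = fgen true by rewrite rE /q eq_sym (negbTE ab) eqxx.
  apply: gen_morph gb => _ [[->|->]|->].
  - by rewrite rp; apply: sub_gen; left.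
  - by rewrite rE /q eqxx; apply: sub_gen; right.
  - by rewrite rc; apply: gen1.
move=> /free_bool_basis[A [B [gA gB rhE]]].
have gs y : gen [set fgen false] y -> gen [set v_ a] (s y).
  by apply: gen_morph => _ ->; rewrite sE; apply: sub_gen.
have ch : commute h (v_ c).
  apply: commute_sym; apply: commute_gen gh => _ [w cw' <-].
  exact: raag_edge_commute.
have hD : commute h D by apply: commute_gen gD => _ ->.
exists (s A), (s B), D; split; [exact: gs|exact: gs|by []|].
by rewrite pE -hD -srh; case: rhE => ->; [left|right];
  rewrite !gmulfM ?multV sE.
Qed.

End Vertices.

(* Positions along the path are counted from 0. *)
Record path_coordinates (Gamma : sgraph) (n : nat) (vx : nat -> Gamma)
    (ix : Gamma -> nat) : Prop := PathCoordinates {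
  ixK : cancel ix vx;
  vxK : forall i, (i < n)%N -> ix (vx i) = i;
  ix_lt : forall u, (ix u < n)%N;
  ix_edge : forall u w, edge u w = ((ix u).+1 == ix w) || ((ix w).+1 == ix u) }.

Section PathRaag.
Variables (Gamma : sgraph) (n : nat) (vx : nat -> Gamma) (ix : Gamma -> nat).
Hypothesis co : path_coordinates n vx ix.
Local Notation G := (raag Gamma).
Local Notation v_ := (@raag_gen Gamma).

Lemma path_power_or_abelian (x : G) :
  (exists g u, gen [set v_ u] (x ^ g)) \/
  (forall y z, commute x y -> commute x z -> commute y z).
Proof.
pose P (x : G) := exists g u, gen [set v_ u] (x ^ g).
suff main k : forall x, parabolic [set u | (ix u < k)%N] x ->
    P x \/ abelian_centralizer (parabolic [set u | (ix u < k)%N]) x.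
  have top y : parabolic [set u | (ix u < n)%N] y.
    by apply: parabolic_mono (parabolicT y) => u _; apply: ix_lt co u.
  have [|ab] := main n x (top x); first by left.
  by right=> y z; apply: ab.
clear x; elim: k => [|k IHk] x Sx.
  by right=> y z Sy Sz _ _; apply: commute_gen Sz => a [u].
have [kn|nk] := ltnP k n; last first.
  have E : [set u | (ix u < k.+1)%N] = [set u | (ix u < k)%N].
    apply/seteqP; split=> u /= _; last by rewrite ltnS ltnW // (leq_trans (ix_lt co u)).
    exact: leq_trans (ix_lt co u) nk.
  by rewrite E in Sx *; apply: IHk.
pose v := vx k; pose S := [set u | (ix u < k.+1)%N].
have Sv : S v by rewrite /S /= (vxK co).
have restE : rest S v = parabolic [set u | (ix u < k)%N].
  rewrite /rest; congr parabolic; apply/seteqP; split=> u /=.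
    rewrite /S /= ltnS leq_eqVlt => -[/orP[/eqP uk|//] uv].
    by case: uv; rewrite -(ixK co u) uk.
  move=> uk; split; first by rewrite /S /= leqW.
  by move=> uv; rewrite uv /v (vxK co) // ltnn in uk.
(* Within an initial segment the last vertex has only its predecessor as neighbour. For [k = 0] the
   link is trivial and [k.-1] is a harmless default. *)
have lkP y : link S v y -> gen [set v_ (vx k.-1)] y.
  apply: gen_mono => _ [u [uk vu] <-]; rewrite -(ixK co u).
  move: vu uk; rewrite (ix_edge co) /S /= (vxK co) //.
  by move=> /orP[/eqP <-|/eqP <- //]; rewrite ltnn.
apply: (centralizer_step Sv) => //.
- by move=> y; move=> /lkP; apply: gen_vertex_faithful.
- by move=> y g [g' [u gu]]; exists (g * g'), u; rewrite conjgM.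
- by move=> y /lkP gy; exists 1, (vx k.-1); rewrite conjg1.
- by rewrite restE.
Qed.

End PathRaag.

(** * Automorphisms *)

Section Automorphisms.
Variable Gamma : sgraph.
Local Notation G := (raag Gamma).
Local Notation v_ := (@raag_gen Gamma).
Local Notation endo := {multiplicative G -> G}.

Definition mutually_inverse (phi psi : endo) := cancel phi psi /\ cancel psi phi.

Lemma mutually_inverse_comp (phi psi phi' psi' : endo) :
  mutually_inverse phi psi -> mutually_inverse phi' psi' ->
  mutually_inverse (phi \o phi' : endo) (psi' \o psi : endo).
Proof.
by move=> [k1 k2] [k1' k2']; split=> x /=; rewrite ?k1 ?k1' ?k2' ?k2.
Qed.

Lemma conj_automorphism g : exists phi psi : endo,
  mutually_inverse phi psi /\ forall x, phi x = x ^ g.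
Proof.
have [phi phiE] := @multiplicative_of G G (fun x => x ^ g) (fun x y => conjMg x y g).
have [psi psiE] := @multiplicative_of G G (fun x => x ^ g^-1) (fun x y => conjMg x y g^-1).
exists phi, psi; split=> //.
by split=> x; rewrite phiE psiE ?conjgK ?conjgKV.
Qed.

(** The last two hypotheses range over all extensions of [s] and [t], so that they can be checked
    before an extension is chosen. *)
Lemma raag_automorphism (s t : Gamma -> G) :
  (forall u w, edge u w -> commute (s u) (s w)) ->
  (forall u w, edge u w -> commute (t u) (t w)) ->
  (forall phi : endo, (forall u, phi (v_ u) = s u) -> forall u, phi (t u) = v_ u) ->
  (forall psi : endo, (forall u, psi (v_ u) = t u) -> forall u, psi (s u) = v_ u) ->
  exists phi psi : endo, mutually_inverse phi psi /\ forall u, phi (v_ u) = s u.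
Proof.
move=> /raag_lift[phi phiE] /raag_lift[psi psiE] phit psis.
exists phi, psi; split=> //; split=> x.
  have : (psi \o phi : endo) =1 (idfun : endo).
    by apply: raag_ext => u /=; rewrite phiE psis.
  exact.
have : (phi \o psi : endo) =1 (idfun : endo).
  by apply: raag_ext => u /=; rewrite psiE phit.
exact.
Qed.

Lemma inversion_automorphism u : exists phi psi : endo,
  [/\ mutually_inverse phi psi, phi (v_ u) = (v_ u)^-1
    & forall w, w <> u -> phi (v_ w) = v_ w].
Proof.
pose s w := if w == u then (v_ w)^-1 else v_ w.
have sE a b : edge a b -> commute (s a) (s b).
  move=> ab; have cab := raag_edge_commute ab.
  have cab' : commute (v_ a) (s b) by rewrite /s; case: ifP => // _; apply: commuteV.
  by rewrite {1}/s; case: ifP => // _; apply/commute_sym/commuteV/commute_sym.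
have inv (f : endo) : (forall w, f (v_ w) = s w) -> forall w, f (s w) = v_ w.
  by move=> fE w; rewrite /s; case: ifP => wu; rewrite ?multV fE /s wu ?groupVK.
have [phi [psi [pp phiE]]] := raag_automorphism sE sE inv inv.
exists phi, psi; split=> //; first by rewrite phiE /s eqxx.
by move=> w /eqP wu; rewrite phiE /s (negbTE wu).
Qed.

Lemma signed_automorphism u y : y = v_ u \/ y = (v_ u)^-1 ->
  exists phi psi : endo, [/\ mutually_inverse phi psi, phi (v_ u) = y
    & forall w, w <> u -> phi (v_ w) = v_ w].
Proof.
case=> ->; last exact: inversion_automorphism.
by exists (idfun : endo), (idfun : endo).
Qed.

(** [a] is spelled by vertices outside [C], hence fixed by the map; conjugating [C] by [a^-1] is
    therefore the inverse. Only relations across the boundary of [C] need the commutation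
    hypothesis. *)
Lemma partial_conj_automorphism (C : pred Gamma) (a : G) :
  gen (v_ @` [set u | ~~ C u]) a ->
  (forall u w, edge u w -> C u -> ~~ C w -> commute a (v_ w)) ->
  exists phi psi : endo, [/\ mutually_inverse phi psi,
    forall u, C u -> phi (v_ u) = v_ u ^ a & forall u, ~~ C u -> phi (v_ u) = v_ u].
Proof.
move=> ga aC; pose s (a : G) u := if C u then v_ u ^ a else v_ u.
have sE b : (forall u w, edge u w -> C u -> ~~ C w -> commute b (v_ w)) ->
    forall u w, edge u w -> commute (s b u) (s b w).
  move=> bC u w uw; have cuw := raag_edge_commute uw; rewrite /s.
  case: (boolP (C u)) => Cu; case: (boolP (C w)) => Cw //.
  - exact: commuteJ.
  - rewrite -(@conj_commute _ (v_ w) b); first exact: commuteJ.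
    by apply: commute_sym; apply: bC uw Cu Cw.
  - rewrite -(@conj_commute _ (v_ u) b); first exact: commuteJ.
    by apply: commute_sym; apply: (bC w u) => //; rewrite edge_sym.
have sfix b (f : endo) : (forall u, f (v_ u) = s b u) -> f a = a.
  move=> fE; apply: (@eq_on_gen _ _ f (idfun : endo) _ _ _ ga) => _ [u Cu <-] /=.
  by rewrite fE /s (negbTE Cu).
have [|||phi [psi [pp phiE]]] := @raag_automorphism (s a) (s a^-1) (sE a aC).
- apply: sE => u w uw Cu Cw; apply/commute_sym/commuteV/commute_sym; exact: aC uw Cu Cw.
- move=> f fE u; rewrite /s; case: ifP => Cu; rewrite ?multJ fE /s Cu //.
  by rewrite multV (sfix _ _ fE) conjgK.
- move=> f fE u; rewrite /s; case: ifP => Cu; rewrite ?multJ fE /s Cu //.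
  by rewrite (sfix _ _ fE) conjgKV.
exists phi, psi; split=> // u Cu; rewrite phiE /s ?Cu //.
by rewrite (negbTE Cu).
Qed.

(** [a] and [b] avoid [u], so both are fixed, and multiplying by their inverses undoes the map. The
    relation between [u] and [c] survives as [a] and [b] commute with [c]. *)
Lemma leaf_automorphism u c (a b : G) : (forall w, edge u w -> w = c) ->
  gen (v_ @` [set w | w <> u]) a -> gen (v_ @` [set w | w <> u]) b ->
  commute a (v_ c) -> commute b (v_ c) ->
  exists phi psi : endo, [/\ mutually_inverse phi psi,
    phi (v_ u) = a * v_ u * b & forall w, w <> u -> phi (v_ w) = v_ w].
Proof.
move=> uc ga gb ac bc.
pose s (a b : G) w := if w == u then a * v_ u * b else v_ w.
have sE a' b' : commute a' (v_ c) -> commute b' (v_ c) ->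
    forall x y, edge x y -> commute (s a' b' x) (s a' b' y).
  move=> ac' bc' x y xy; rewrite /s.
  have uE w : edge u w -> commute (a' * v_ u * b') (v_ w).
    move=> uw; rewrite (uc w uw); apply: commute_sym.
    apply: commuteM; last exact: commute_sym.
    apply: commuteM; first exact: commute_sym.
    by rewrite -(uc w uw); apply/commute_sym/raag_edge_commute.
  case: eqVneq => xu; case: eqVneq => yu.
  - exact: commute_refl.
  - by apply: uE; rewrite -xu.
  - by apply: commute_sym; apply: uE; rewrite -yu edge_sym.
  - exact: raag_edge_commute.
have sfix a' b' (f : endo) : (forall w, f (v_ w) = s a' b' w) ->
    forall y, gen (v_ @` [set w | w <> u]) y -> f y = y.
  move=> fE y gy; apply: (@eq_on_gen _ _ f (idfun : endo) _ _ _ gy) => _ [w /eqP wu <-] /=.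
  by rewrite fE /s (negbTE wu).
have [|||phi [psi [pp phiE]]] := @raag_automorphism (s a b) (s a^-1 b^-1) (sE _ _ ac bc).
- by apply: sE; apply/commute_sym/commuteV/commute_sym.
- move=> f fE w; rewrite /s; case: eqVneq => [->|wu]; last by rewrite fE /s (negbTE wu).
  rewrite !gmulfM fE /s eqxx !multV (sfix _ _ _ fE _ ga) (sfix _ _ _ fE _ gb).
  by rewrite !mulgA mulVg mul1g mulgK.
- move=> f fE w; rewrite /s; case: eqVneq => [->|wu]; last by rewrite fE /s (negbTE wu).
  rewrite !gmulfM fE /s eqxx (sfix _ _ _ fE _ ga) (sfix _ _ _ fE _ gb).
  by rewrite !mulgA mulgV mul1g mulgVK.
exists phi, psi; split=> //; first by rewrite phiE /s eqxx.
by move=> w /eqP wu; rewrite phiE /s (negbTE wu).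
Qed.

End Automorphisms.

Section Transport.
Variables (G : groupType) (phi psi : {multiplicative G -> G}).
Hypotheses (phiK : cancel phi psi) (psiK : cancel psi phi).

Lemma commute_transport x y : commute (psi x) y -> commute x (phi y).
Proof. by move=> c; rewrite -(psiK x); apply: gmulf_commute. Qed.

Lemma inner_pearl_transport x : inner_pearl x -> inner_pearl (psi x).
Proof.
move=> [x1 nab xc]; have cT y : commute (psi x) y <-> commute x (phi y).
  split; first exact: commute_transport.
  by move=> /(gmulf_commute psi); rewrite phiK.
split.
- by move=> /(congr1 phi); rewrite psiK mult1.
- move=> ab; apply: nab => y z; rewrite /centralizer /= => cy cz.
  rewrite -(psiK y) -(psiK z); apply: gmulf_commute; apply: ab.
    by apply/cT; rewrite psiK.
  by apply/cT; rewrite psiK.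
- apply/seteqP; split=> y.
    move=> gy; have gx : gen [set x] (phi y).
      by apply: gen_morph gy => _ ->; rewrite psiK; apply: sub_gen.
    move: gx; rewrite xc => -[cx cy]; split; first exact/cT.
    move=> z; rewrite /centralizer /= => /cT/cy.
    by move=> /(gmulf_commute psi); rewrite !phiK.
  move=> [/cT cx cy]; have : center (centralizer x) (phi y).
    split=> // z cz; rewrite -(psiK z); apply: gmulf_commute; apply: cy.
    by apply/cT; rewrite psiK.
  rewrite -xc => /(gen_morph (h := psi)) gy; rewrite -(phiK y); apply: gy.
  by move=> _ ->; apply: sub_gen.
Qed.

End Transport.

(** * Chains of pearls *)

(** Consequences of the conditions that survive automorphisms, with [q i] standing for p_{i+1} so
    that pearls are numbered from 0 like the vertices. [chain_gen] comes from (E) at [i = 1] and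
    [i = m - 2], and from (T) in between. *)
Record pearl_chain (G : groupType) (m : nat) (q : nat -> G) : Prop := PearlChain {
  chain_inner : forall i, (0 < i <= m - 2)%N -> inner_pearl (q i);
  chain_inner2 : inner_pearl (q 2%N);
  chain_inner3 : inner_pearl (q (m - 3)%N);
  chain_gen : forall i, (0 < i <= m - 2)%N -> forall y, commute (q i) y ->
    gen [set q i.+1; q i.-1; q i] y;
  chain_prev : forall i, (0 < i <= m - 2)%N -> commute (q i) (q i.-1);
  chain_next : forall i, (0 < i <= m - 2)%N -> commute (q i) (q i.+1);
  chain_cup : cup_isolated (q 1%N);
  chain_cup' : cup_isolated (q (m - 2)%N);
  chain_sep : exists z, commute (q 1%N) z /\ ~ commute (q 2%N) z }.

Lemma chain_transport (G : groupType) m (q : nat -> G)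
    (phi psi : {multiplicative G -> G}) : cancel phi psi -> cancel psi phi ->
  pearl_chain m q -> pearl_chain m (psi \o q).
Proof.
move=> phiK psiK [q_in q2 q3 q_gen q_prev q_next qc qc' [z [cz ncz]]].
have ip := inner_pearl_transport phiK psiK.
have cup y : cup_isolated y -> cup_isolated (psi y).
  by move=> ciy; apply: (cup_isolated_morph phiK psiK); rewrite psiK.
split=> //=; try by [apply: ip|apply: cup].
- by move=> i im; apply: ip; apply: q_in.
- move=> i im y /(commute_transport psiK) /(q_gen i im) gy.
  rewrite -(phiK y); apply: gen_morph gy => _ [[->|->]|->]; apply: sub_gen.
  + by left; left.
  + by left; right.
  + by right.
- by move=> i im; apply: gmulf_commute; apply: q_prev.
- by move=> i im; apply: gmulf_commute; apply: q_next.
- exists (psi z); split; first exact: gmulf_commute.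
  by move=> /(gmulf_commute phi); rewrite !psiK.
Qed.

(** Lifts of generators of the quotient generate C(x) once [x] is added, since the kernel is
    generated by [x]. *)
Lemma condT_generates (G : groupType) (y x z : G) : condT y x z ->
  forall w, commute x w -> gen [set z; y; x] w.
Proof.
move=> [_ _ cy cz]; set N := NormalSubgroup _; set T := [set _ | _ in _] => gT w cw.
have Cw : subgroup_pred (centralizer_of x) w by apply/mem_set.
pose u : subg (centralizer_of x) := Subg Cw.
have : gen T (to_quot N u) by rewrite gT.
pose B : set (quot N) := [set t | exists2 c, to_quot N c = t & gen [set z; y; x] (val c)].
have sB : is_subgroup B.
  split; first by exists 1 => //; apply: gen1.
    move=> _ _ [c <- gc] [d <- gd]; exists (c * d); first exact: to_quotM.
    exact: genM.
  move=> _ [c <- gc]; exists c^-1; first exact: to_quotV.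
  exact: genV.
move=> /(gen_min sB) [].
  move=> _ [c cE <-]; exists c => //; apply: sub_gen.
  by case: cE => ->; left; [right|left].
move=> c /to_quotP; rewrite /= /cycle_in_centralizer /= => cu gc.
rewrite -(mulVKg (val c) w); apply: genM => //.
by apply: gen_mono cu => _ ->; right.
Qed.

Section Chain.
Variables (Gamma : sgraph) (n : nat) (vx : nat -> Gamma) (ix : Gamma -> nat).
Hypothesis co : path_coordinates n vx ix.
Local Notation G := (raag Gamma).
Local Notation v_ := (@raag_gen Gamma).
Local Notation x_ i := (v_ (vx i)).
Local Notation endo := {multiplicative G -> G}.

Lemma vx_edge i j : (i < n)%N -> (j < n)%N ->
  edge (vx i) (vx j) = (i.+1 == j) || (j.+1 == i).
Proof. by move=> i_n jn; rewrite (ix_edge co) !(vxK co). Qed.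

Lemma edge_succ i : (i.+1 < n)%N -> edge (vx i) (vx i.+1).
Proof. by move=> i_n; rewrite vx_edge ?eqxx // ltnW. Qed.

Lemma vx_neq i j : (i < n)%N -> (j < n)%N -> i != j -> vx i <> vx j.
Proof. by move=> i_n jn /eqP ij /(congr1 ix); rewrite !(vxK co). Qed.

Lemma vx_eqF i j : (i < n)%N -> (j < n)%N -> i != j -> (vx i == vx j) = false.
Proof. by move=> i_n jn ij; apply/eqP; apply: vx_neq. Qed.

Lemma edge_vx i w : (i < n)%N -> edge (vx i) w ->
  (exists2 j, i = j.+1 & w = vx j) \/ (i.+1 < n)%N /\ w = vx i.+1.
Proof.
move=> i_n; rewrite (ix_edge co) (vxK co) // => /orP[/eqP iw|/eqP wi].
  by right; rewrite iw (ix_lt co) (ixK co).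
by left; exists (ix w); rewrite ?(ixK co).
Qed.

Lemma path_inner_pearl x : inner_pearl x ->
  exists i, [/\ (0 < i)%N, (i.+1 < n)%N & conj_pm (x_ i) x].
Proof.
move=> /(inner_pearl_conj (path_power_or_abelian co))[u ux].
move=> /nonabelian_centralizer_degree[w1 [w2 [uw1 uw2 w12]]].
have un := ix_lt co u; rewrite -(ixK co u) in ux uw1 uw2.
exists (ix u); split=> //.
- rewrite lt0n; apply/eqP => u0; rewrite u0 in un uw1 uw2; apply: w12.
  by case: (edge_vx un uw1) => [[]//|[_ ->]]; case: (edge_vx un uw2) => [[]//|[_ ->]].
- rewrite ltnNge; apply/negP => nu; apply: w12.
  case: (edge_vx un uw1) => [[j uj ->]|[]]; last by rewrite ltnNge nu.
  case: (edge_vx un uw2) => [[k uk ->]|[]]; last by rewrite ltnNge nu.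
  by move: uk; rewrite uj => -[->].
Qed.

Lemma path_cup_isolated i y : (0 < i)%N -> (i.+1 < n)%N -> conj_pm (x_ i) y ->
  cup_isolated y -> i = 1%N \/ i.+2 = n.
Proof.
move=> i0 i_n [g yE] /(raag_cup_isolated (i := vx i))[|u [ui uw]].
  move=> f fM; case: yE => ->; rewrite additiveJ // additiveV //.
  by split=> [/eqP|->]; rewrite ?oppr0 // oppr_eq0 => /eqP.
have un := ix_lt co u; have i_n' := ltnW i_n.
case uE: (ix u) => [|k] in un.
  left; have := uw (vx 1); rewrite -{1}(ixK co u) uE.
  have n1 : (1 < n)%N by apply: leq_ltn_trans i_n.
  move=> /(_ (edge_succ n1)) /(congr1 ix).
  by rewrite !(vxK co).
have ki : k = i.
  have := uw (vx k); rewrite -{1}(ixK co u) uE edge_sym => /(_ (edge_succ un)).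
  by move=> /(congr1 ix); rewrite !(vxK co) // ltnW.
right; apply/eqP; rewrite eqn_leq i_n /= leqNgt; apply/negP => i3n.
rewrite -ki in i3n; have := uw (vx k.+2); rewrite -{1}(ixK co u) uE.
move=> /(_ (edge_succ i3n)) /(congr1 ix); rewrite !(vxK co) // -ki; lia.
Qed.

Variables (m : nat).
Implicit Type q : nat -> G.

(** The value at [u] is written [Posz (u == u)] to match what [vertex_count] provides. *)
Lemma gen_vertex_count u y (f : G -> int) : gen [set v_ u] y ->
  additive_to_int f -> f (v_ u) = Posz (u == u) -> f y = 0%R -> y = 1.
Proof.
move=> /gen1P[l yE] fM; rewrite eqxx => fu.
case: yE => ->; rewrite ?additiveV // additiveX // fu.
  by case: l => // l; lia.
by case: l => [|l]; rewrite ?expg0 ?invg1 //; lia.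
Qed.

(** The vertex [x_ j] lies in the centralizer of [q i]. If its exponent sum vanished on all three
    generators of this centralizer, it would vanish on [x_ j] too. *)
Lemma count_gen q i j : pearl_chain m q -> (0 < i <= m - 2)%N -> q i = x_ i ->
  (i < n)%N -> (j < n)%N -> i != j -> edge (vx i) (vx j) ->
  (forall f : G -> int, additive_to_int f ->
     (forall w, f (v_ w) = Posz (w == vx j)) -> f (q i.-1) = 0%R) ->
  exists f : G -> int, [/\ additive_to_int f,
    forall w, f (v_ w) = Posz (w == vx j) & f (q i.+1) <> 0%R].
Proof.
move=> qc im qi i_n jn ij eij f0.
have [f [fM fE]] := vertex_count (vx j); exists f; split=> // fq.
have : commute (q i) (x_ j) by rewrite qi; apply: raag_edge_commute.
move=> /(chain_gen qc im) /(additive_gen fM); rewrite fE eqxx => H.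
have : (1 : int) = 0%R; last by [].
apply: H => _ [[->|->]|->] //; first exact: f0.
by rewrite qi fE vx_eqF.
Qed.

Lemma chain_step q k : pearl_chain m q -> (1 < k)%N -> (k < m - 2)%N ->
  (k.+1 < n)%N -> (forall i, (0 < i <= k)%N -> q i = x_ i) ->
  (k.+2 < n)%N /\ exists phi psi : endo, mutually_inverse phi psi /\
    forall i, (0 < i <= k.+1)%N -> q i = phi (x_ i).
Proof.
case: k => [//|k] qc k1 km kn qE; rewrite ltnS in k1.
have km' : (0 < k.+1 <= m - 2)%N by rewrite /= ltnW.
have km2 : (0 < k.+2 <= m - 2)%N by [].
have qk : q k.+1 = x_ k.+1 by apply: qE; rewrite leqnn.
have qk' : q k = x_ k by apply: qE; rewrite k1 leqnSn.
have kn1 := ltnW kn; have kn0 := ltnW kn1.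
have [f [fM fE fq]] : exists f : G -> int, [/\ additive_to_int f,
    forall w, f (v_ w) = Posz (w == vx k.+2) & f (q k.+2) <> 0%R].
  apply: (count_gen qc km' qk) => //; first by rewrite neq_ltn ltnSn.
    exact: edge_succ.
  by move=> f fM fE; rewrite qk' fE vx_eqF // neq_ltn leqnSn.
(* The exponent sum found above identifies the vertex of this pearl. Inner pearls avoid the end
   vertices, which yields the bound on [n]. *)
have [i [i0 i_n [g qi]]] := path_inner_pearl (chain_inner qc km2).
have iE : i = k.+2.
  apply: contrapT => /eqP ik; apply: fq.
  by case: qi => ->; rewrite additiveJ // ?additiveV // fE vx_eqF // ltnW.
rewrite {}iE in i_n qi; split=> //.
have [|||||||A [B [D [gA gB gD pE]]]] :=
    @neighbour_form Gamma (vx k) (vx k.+2) (vx k.+1) (q k.+2).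
- by rewrite edge_sym; apply: edge_succ.
- exact: edge_succ.
- by apply: vx_neq => //; rewrite neq_ltn leqnSn.
- rewrite vx_edge //; apply/norP; split; apply/eqP; lia.
- move=> w /(edge_vx kn1)[[j [->] ->]|[_ ->]]; by [left|right].
- by rewrite -qk; apply/commute_sym/(chain_next qc km').
- have : commute (q k.+1) (x_ k.+2) by rewrite qk; apply/raag_edge_commute/edge_succ.
  by move=> /(chain_gen qc km'); rewrite qk /= qk'.
have count0 j : (j < n)%N -> j != k.+2 -> forall f' : G -> int, additive_to_int f' ->
    (forall w, f' (v_ w) = Posz (w == vx j)) -> f' (q k.+2) = 0%R.
  move=> jn jk f' fM' fE'; by case: qi => ->;
    rewrite additiveJ // ?additiveV // fE' vx_eqF // eq_sym.
(* A conjugate of the vertex at [k.+2] or of its inverse has exponent sum 0 at [k.+1], which is that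
   of [D], and at [k], which is that of [A * B]. *)
have D1 : D = 1.
  have [f' [fM' fE']] := vertex_count (vx k.+1).
  apply: (gen_vertex_count gD fM' (fE' _)).
  have := count0 _ kn1 _ f' fM' fE'.
  have fA : f' A = 0%R by apply: (additive_gen fM' _ gA) => _ ->; rewrite fE' vx_eqF // neq_ltn ltnSn.
  have fB : f' B = 0%R by apply: (additive_gen fM' _ gB) => _ ->; rewrite fE' vx_eqF // neq_ltn ltnSn.
  have fx : f' (x_ k.+2) = 0%R by rewrite fE' vx_eqF // neq_ltn ltnSn orbT.
  case: pE => ->; rewrite !fM' ?additiveV // fA fB fx; rewrite ?oppr0 !add0r;
  by apply; rewrite neq_ltn ltnSn.
have AB : A * B = 1.
  have [f' [fM' fE']] := vertex_count (vx k).
  apply: (gen_vertex_count (genM gA gB) fM' (fE' _)).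
  have := count0 _ kn0 _ f' fM' fE'.
  have fx : f' (x_ k.+2) = 0%R by rewrite fE' vx_eqF // neq_ltn leqnSn orbT.
  case: pE => ->; rewrite D1 !fM' ?additiveV // fx additive1 // ?oppr0 !addr0;
  by apply; rewrite neq_ltn leqnSn.
have {AB} BA : B = A^-1 by rewrite (mulg1_eq AB).
have [y yE qky] : exists2 y, y = x_ k.+2 \/ y = (x_ k.+2)^-1 & q k.+2 = y ^ A^-1.
  case: pE => ->; rewrite D1 BA mulg1 /conjg groupVK -mulgA.
    by exists (x_ k.+2); [left|].
  by exists (x_ k.+2)^-1; [right|].
have [phi1 [psi1 [inv1 phi1E phi1F]]] := signed_automorphism yE.
(* Everything beyond position [k.+1] is conjugated. The only outside vertex adjacent to this set is
   [vx k.+1], which commutes with [A], and the pearls already placed do not move. *)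
have [||phi2 [psi2 [inv2 phi2C phi2N]]] := @partial_conj_automorphism Gamma (fun u => (k.+1 < ix u)%N) A^-1.
- apply: genV; apply: gen_mono gA => _ ->; exists (vx k) => //=.
  by rewrite (vxK co) // -leqNgt leqnSn.
- move=> u w; rewrite (ix_edge co) -leqNgt => uw ku wk.
  have -> : w = vx k.+1 by rewrite -(ixK co w); congr vx; move: uw => /orP[/eqP|/eqP]; lia.
  apply/commute_sym/commuteV.
  apply: commute_gen gA => _ ->; apply: raag_edge_commute.
  by rewrite edge_sym edge_succ.
exists (phi2 \o phi1 : endo), (psi1 \o psi2 : endo); split; first exact: mutually_inverse_comp.
move=> j /andP[j0]; rewrite leq_eqVlt => /orP[/eqP ->|jk] /=.
  rewrite phi1E qky; have phi2x : phi2 (x_ k.+2) = x_ k.+2 ^ A^-1 by apply: phi2C; rewrite (vxK co).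
  by case: yE => ->; rewrite ?multV phi2x ?conjVg.
have jn : (j < n)%N by apply: ltn_trans jk _.
rewrite phi1F; last by apply: vx_neq => //; rewrite neq_ltn jk.
rewrite phi2N; last by rewrite (vxK co) // -leqNgt -ltnS.
by apply: qE; rewrite j0 -ltnS.
Qed.

Lemma conj_pm_automorphism i y : (i < n)%N -> conj_pm (x_ i) y ->
  exists phi psi : endo, mutually_inverse phi psi /\ y = phi (x_ i).
Proof.
move=> i_n [g yE]; have [c [c' [invc cE]]] := conj_automorphism g.
have [y0 y0E yE'] : exists2 y0, y0 = x_ i \/ y0 = (x_ i)^-1 & y = y0 ^ g.
  by case: yE => ->; [exists (x_ i); [left|]|exists (x_ i)^-1; [right|]].
have [phi [psi [inv phiE _]]] := signed_automorphism y0E.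
exists (c \o phi : endo), (psi \o c' : endo); split; first exact: mutually_inverse_comp.
by rewrite /= phiE cE.
Qed.

Lemma chain_second q : pearl_chain m q -> (2 < m)%N -> (2 < n)%N -> q 1%N = x_ 1 ->
  (3 < n)%N /\ exists phi psi : endo,
    [/\ mutually_inverse phi psi, q 1%N = phi (x_ 1) & q 2%N = phi (x_ 2)].
Proof.
move=> qc m2 n2 q1; have [i [i0 i_n qi]] := path_inner_pearl (chain_inner2 qc).
have n1 := ltnW n2.
have im : (0 < 1 <= m - 2)%N by rewrite /= subn_gt0.
have cq : commute (q 2%N) (x_ 1) by rewrite -q1; apply/commute_sym/(chain_next qc im).
have [star [h [ch qh]]] := conj_in_star cq qi.
have hfix : x_ 1 ^ h = x_ 1 by apply: conj_commute; apply: commute_sym.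
(* In the star of [vx 1], position 0 is impossible for an inner pearl, and position 1 would make
   [q 2] equal to [x_ 1] up to sign, against [chain_sep]. *)
have iE : i = 2%N.
  case: star => [/(congr1 ix)|]; last first.
    by rewrite vx_edge ?(ltnW i_n) // => /orP[/eqP <-|/eqP]; lia.
  rewrite !(vxK co) ?(ltnW i_n) // => i1; rewrite {}i1 in qh.
  have [z [cz []]] := chain_sep qc; rewrite q1 in cz.
  case: qh => ->; rewrite ?conjVg hfix //.
  exact/commute_sym/commuteV/commute_sym.
rewrite {}iE in i_n qh; split=> //.
have [c [c' [invc cE]]] := conj_automorphism h.
have [y yE qy] : exists2 y, y = x_ 2 \/ y = (x_ 2)^-1 & q 2%N = y ^ h.
  by case: qh => ->; [exists (x_ 2); [left|]|exists (x_ 2)^-1; [right|]].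
have [phi [psi [inv phiE phiN]]] := signed_automorphism yE.
exists (c \o phi : endo), (psi \o c' : endo); split; first exact: mutually_inverse_comp.
  by rewrite /= phiN ?cE ?hfix //; apply: vx_neq.
by rewrite /= phiE cE.
Qed.

(** For [m = 3] both neighbours of [q 1] in the chain are inner pearls, hence have exponent sum 0 at
    the end [vx 0], as has [q 1]. Yet together they generate a centralizer containing [x_ 0]. *)
Lemma chain_length q : pearl_chain m q -> m = 3%N -> (2 < n)%N -> q 1%N = x_ 1 -> False.
Proof.
move=> qc m3 n2 q1; have n1 := ltnW n2; have n0 := ltnW n1.
have f0 y (f : G -> int) : inner_pearl y -> additive_to_int f ->
    (forall w, f (v_ w) = Posz (w == vx 0)) -> f y = 0%R.
  move=> /path_inner_pearl[i [i0 i_n [g yE]]] fM fE.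
  by case: yE => ->; rewrite additiveJ // ?additiveV // fE vx_eqF ?(ltnW i_n) // -lt0n.
have [f [fM fE []]] : exists f : G -> int, [/\ additive_to_int f,
    forall w, f (v_ w) = Posz (w == vx 0) & f (q 2%N) <> 0%R].
  apply: (count_gen qc _ q1) => //; first by rewrite m3.
    by rewrite edge_sym; apply: edge_succ.
  by move=> f; apply: f0; have := chain_inner3 qc; rewrite m3.
exact: (f0 _ _ (chain_inner2 qc)).
Qed.

(** At each stage the whole chain is pulled back by the automorphism found so far, so that
    [chain_step] meets pearls that are equal to vertices. *)
Lemma chain_interior q : pearl_chain m q -> (3 < m)%N -> (2 < n)%N ->
  conj_pm (x_ 1) (q 1%N) ->
  (m - 1 < n)%N /\ exists phi psi : endo, mutually_inverse phi psi /\
    forall i, (0 < i <= m - 2)%N -> q i = phi (x_ i).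
Proof.
move=> qc m3 n2 q1; have n1 := ltnW n2.
suff main k : (2 <= k <= m - 2)%N -> (k.+1 < n)%N /\
    exists phi psi : endo, mutually_inverse phi psi /\
      forall i, (0 < i <= k)%N -> q i = phi (x_ i).
  have [|kn ex] := main (m - 2)%N; first by lia.
  by split=> //; move: kn; lia.
elim: k => // k IHk; case: (ltngtP k 1) => [k1|k1|->] km; first by lia.
  have [|kn [phi [psi [[phiK psiK] qE]]]] := IHk; first by lia.
  have qc' := chain_transport phiK psiK qc.
  have [||||k2n [f [g [inv fE]]]] := chain_step qc' (k := k); try lia.
    by move=> i ik /=; rewrite qE.
  split=> //; exists (phi \o f : endo), (g \o psi : endo); split.
    exact: mutually_inverse_comp.
  by move=> i ik /=; rewrite -fE //= psiK.
have [phi [psi [[phiK psiK] qE]]] := conj_pm_automorphism n1 q1.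
have qc' := chain_transport phiK psiK qc.
have [||n3 [f [g [inv f1 f2]]]] := chain_second qc' _ n2; first by lia.
  by rewrite /= qE.
split=> //; exists (phi \o f : endo), (g \o psi : endo); split.
  exact: mutually_inverse_comp.
by case=> [|[|[|]]] //= _; rewrite -?f1 -?f2 /= psiK.
Qed.

(** The sign change is applied after the transvection: it fixes [A], [B] and [D], which avoid [u],
    and only alters the middle factor. *)
Lemma end_automorphism (u c a : Gamma) (p : G) : edge c a -> edge c u -> a <> u ->
  ~~ edge a u -> (forall w, edge u w -> w = c) ->
  (forall w, edge c w -> w = a \/ w = u) -> commute p (v_ c) ->
  gen [set p; v_ a; v_ c] (v_ u) ->
  exists phi psi : endo, [/\ mutually_inverse phi psi, phi (v_ u) = p
    & forall w, w <> u -> phi (v_ w) = v_ w].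
Proof.
move=> ca cu au nau uc cw cp gu.
have [A [B [D [gA gB gD pE]]]] := neighbour_form ca cu au nau cw cp gu.
have cu' : c <> u by move=> E; rewrite E edge_irr in cu.
have gu' w y : w <> u -> gen [set v_ w] y -> gen (v_ @` [set w | w <> u]) y.
  by move=> wu; apply: gen_mono => _ ->; exists w.
have cA : commute (v_ c) A.
  by apply: commute_gen gA => _ ->; apply: raag_edge_commute.
have cB : commute (v_ c) B.
  by apply: commute_gen gB => _ ->; apply: raag_edge_commute.
have cD : commute (v_ c) D by apply: commute_gen gD => _ ->.
have [||||phi [psi [inv phiE phiN]]] := @leaf_automorphism Gamma u c A (B * D) uc.
- exact: gu' gA.
- by apply: genM; [apply: gu' gB|apply: gu' gD].
- exact: commute_sym.
- exact/commute_sym/commuteM.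
have [y yE pyE] : exists2 y, y = v_ u \/ y = (v_ u)^-1 & p = A * y * (B * D).
  by case: pE => ->; [exists (v_ u); [left|rewrite mulgA]|exists (v_ u)^-1; [right|rewrite mulgA]].
have [f [g [inv' fE fN]]] := signed_automorphism yE.
have ffix z : gen (v_ @` [set w | w <> u]) z -> f z = z.
  move=> gz; apply: (@eq_on_gen _ _ f (idfun : endo) _ _ _ gz) => _ [w wu <-] /=.
  exact: fN.
exists (f \o phi : endo), (psi \o g : endo); split; first exact: mutually_inverse_comp.
  rewrite /= phiE !gmulfM fE pyE (ffix A) ?(ffix B) ?(ffix D) //.
  - exact: gu' gD.
  - exact: gu' gB.
  - exact: gu' gA.
by move=> w wu; rewrite /= phiN // fN.
Qed.

Lemma chain_ends q : pearl_chain m q -> (3 < m)%N -> (m - 1 < n)%N ->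
  (forall i, (0 < i <= m - 2)%N -> q i = x_ i) ->
  m = n /\ exists phi psi : endo, mutually_inverse phi psi /\
    forall i, (i < n)%N -> q i = phi (x_ i).
Proof.
move=> qc m3 mn qE.
have m2 : (0 < m - 2 <= m - 2)%N by lia.
(* The pearl [q (m - 2)] sits at position m - 2, which must be 1 or n - 2; the first is excluded by
   [m > 3]. *)
have mE : m = n.
  have y1 : conj_pm (x_ (m - 2)) (q (m - 2)%N) by exists 1; left; rewrite qE // conjg1.
  by have := path_cup_isolated _ _ y1 (chain_cup' qc); lia.
split=> //; subst m.
have im1 : (0 < 1 <= n - 2)%N by lia.
have n1 : (1 < n)%N by lia.
have n2 : (2 < n)%N by lia.
have q1 := qE 1%N im1.
have [||||||||phi [psi [inv phi0 phiN]]] :=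
    @end_automorphism (vx 0) (vx 1) (vx 2) (q 0%N).
- exact: edge_succ.
- by rewrite edge_sym; apply: edge_succ; apply: ltnW.
- by apply: vx_neq => //; lia.
- by rewrite vx_edge //; lia.
- by move=> w /(edge_vx (ltnW n1))[[j //]|[_ ->]].
- move=> w /(edge_vx n1)[[j [<-] ->]|[_ ->]]; [by right|by left].
- by rewrite -q1; apply/commute_sym/(chain_prev qc im1).
- have : commute (q 1%N) (x_ 0).
    by rewrite q1; apply: raag_edge_commute; rewrite edge_sym; apply: edge_succ; lia.
  move=> /(chain_gen qc im1); apply: gen_mono => _ [[->|->]|->] /=.
  + by left; right; rewrite qE //; lia.
  + by left; left.
  + by right.
(* [phi] moves only the vertex [vx 0], so pulling back keeps the interior pearls in place and the
   other end can be treated independently. *)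
have [phiK psiK] := inv; pose q' := psi \o q.
have qc' := chain_transport phiK psiK qc.
have qE' i : (0 < i <= n - 2)%N -> q' i = x_ i.
  move=> im; rewrite /q' /= qE // -{1}(phiN (vx i)) ?phiK //.
  by apply: vx_neq; lia.
have im2 : (0 < n - 2 <= n - 2)%N by lia.
have e2 : (n - 2).+1 = (n - 1)%N by lia.
have e3 : (n - 2).-1 = (n - 3)%N by lia.
have e3' : (n - 3).+1 = (n - 2)%N by lia.
have q2 := qE' _ im2.
have [||||||||f [g [inv' f1 fN]]] :=
    @end_automorphism (vx (n - 1)) (vx (n - 2)) (vx (n - 3)) (q' (n - 1)%N).
- by rewrite edge_sym -e3'; apply: edge_succ; lia.
- by rewrite -e2; apply: edge_succ; lia.
- by apply: vx_neq; lia.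
- by rewrite vx_edge; lia.
- have n1' : (n - 1 < n)%N by lia.
  by move=> w /(edge_vx n1')[[j ? ->]|[]]; [congr vx|]; lia.
- have n2' : (n - 2 < n)%N by lia.
  by move=> w /(edge_vx n2')[[j ? ->]|[_ ->]]; [left|right]; congr vx; lia.
- by rewrite -q2 -e2; apply/commute_sym/(chain_next qc' im2).
- have : commute (q' (n - 2)%N) (x_ (n - 1)).
    by rewrite q2 -e2; apply/raag_edge_commute/edge_succ; lia.
  move=> /(chain_gen qc' im2); rewrite e2 e3 -/q' q2 -(qE' (n - 3)%N) //; lia.
exists (phi \o f : endo), (g \o psi : endo); split; first exact: mutually_inverse_comp.
move=> i i_n /=; have [->|i0] := eqVneq i 0%N.
  by rewrite fN ?phi0 //; apply: vx_neq; lia.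
have [->|i1] := eqVneq i (n - 1)%N; first by rewrite f1 /q' /= psiK.
rewrite fN; last by apply: vx_neq; lia.
rewrite phiN; last by apply: vx_neq; lia.
by apply: qE; lia.
Qed.

Lemma chain_basis q : pearl_chain m q -> (2 < m)%N -> conj_pm (x_ 1) (q 1%N) ->
  m = n /\ exists phi psi : endo, mutually_inverse phi psi /\
    forall i, (i < n)%N -> q i = phi (x_ i).
Proof.
move=> qc m2 q1.
have n2 : (2 < n)%N.
  have im : (0 < 1 <= m - 2)%N by lia.
  by have [i [i0 i_n _]] := path_inner_pearl (chain_inner qc im); lia.
have m3 : (3 < m)%N.
  rewrite ltn_neqAle m2 andbT; apply/eqP => m3.
  have [phi [psi [[phiK psiK] q1E]]] := conj_pm_automorphism (ltnW n2) q1.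
  apply: (chain_length (chain_transport phiK psiK qc)) => //.
  by rewrite /= q1E.
have [mn [phi [psi [inv qE]]]] := chain_interior qc m3 n2 q1.
have [phiK psiK] := inv.
have [|mE [f [g [inv' fE]]]] := chain_ends (chain_transport phiK psiK qc) m3 mn.
  by move=> i im; rewrite /= qE.
split=> //; exists (phi \o f : endo), (g \o psi : endo); split.
  exact: mutually_inverse_comp.
by move=> i i_n /=; rewrite -fE //= psiK.
Qed.

End Chain.

(** * Coordinates on the path and final assembly *)

Lemma path_coordinates_rev (Gamma : sgraph) n vx ix :
  @path_coordinates Gamma n vx ix ->
  @path_coordinates Gamma n (fun i => vx (n.-1 - i)%N) (fun u => (n.-1 - ix u)%N).
Proof.
move=> co; have lt u := ix_lt co u.
split.
- move=> u /=; rewrite subKn ?(ixK co) //; have := lt u; lia.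
- move=> i i_n; rewrite (vxK co); lia.
- move=> u; have := lt u; lia.
- move=> u w; rewrite (ix_edge co); have := lt u; have := lt w; lia.
Qed.

Lemma path_graph_coordinates (Gamma : sgraph) : is_path_graph Gamma ->
  (0 < #|Gamma|)%N -> exists vx ix, @path_coordinates Gamma #|Gamma| vx ix.
Proof.
move=> [f [[g fK gK] fE]] n0.
(* Positions are natural numbers; those out of range are sent to the first vertex. *)
pose vx i := f (insubd (Ordinal n0) i).
exists vx, (fun u => g u : nat); split.
- by move=> u; rewrite /vx valKd gK.
- by move=> i i_n; rewrite /vx fK val_insubd i_n.
- by move=> u; apply: ltn_ord.
- by move=> u w; rewrite -{1}(gK u) -{1}(gK w) fE.
Qed.

Lemma pearl_chain_of_conditions (G : groupType) (m : nat) (p : nat -> G) :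
  (2 < m)%N -> condE (p 1%N) (p 2%N) (p 3%N) ->
  condE (p m) (p (m - 1)%N) (p (m - 2)%N) ->
  (forall i : nat, (3 <= i <= m - 2)%N ->
     condT (p (i - 1)%N) (p i) (p (i + 1)%N)) ->
  pearl_chain m (fun i => p i.+1).
Proof.
move=> m2 [[ip2 ip3 _ [z [cz ncz]]] c2 s2] [[ip2' ip3' _ _] c2' s2'] T.
have gens (x y c : G) : centralizer y = gen [set x; y; c] ->
    [/\ forall w, commute y w -> gen [set c; x; y] w,
        forall w, commute y w -> gen [set x; c; y] w,
        commute y x & commute y c].
  move=> yE; have yE' w : commute y w <-> gen [set x; y; c] w by rewrite -yE.
  split.
  - move=> w /yE'; apply: gen_mono => _ [[->|->]|->].
    by left; right. by right. by left; left.
  - move=> w /yE'; apply: gen_mono => _ [[->|->]|->].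
    by left; left. by right. by left; right.
  - by apply/yE'; apply: sub_gen; left; left.
  - by apply/yE'; apply: sub_gen; right.
have [g2 _ cp2 cn2] := gens _ _ _ c2; have [_ g2' cn2' cp2'] := gens _ _ _ c2'.
have cases i : (0 < i <= m - 2)%N ->
    [\/ i = 1%N, i = (m - 2)%N | condT (p i) (p i.+1) (p i.+2)].
  move=> im; have [->|i1] := eqVneq i 1%N; first by constructor 1.
  have [->|im'] := eqVneq i (m - 2)%N; first by constructor 2.
  constructor 3; have := T i.+1; rewrite subn1 addn1; apply; lia.
have e1 : (m - 2).+1 = (m - 1)%N by lia.
have e2 : (m - 2).+2 = m by lia.
have e3 : (m - 2).-1.+1 = (m - 2)%N by lia.
have e4 : (m - 3).+1 = (m - 2)%N by lia.
split=> //.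
- by move=> i /cases[->|->|[_ []]] //; rewrite e1.
- by rewrite e4.
- move=> i im; have /andP[i0 _] := im.
  case: (cases i im) => [->|->|/condT_generates] //; first by rewrite e2 e1 e3.
  by rewrite prednK.
- move=> i im; have /andP[i0 _] := im.
  case: (cases i im) => [->|->|[_ _ ? _ _]] //; first by rewrite e1 e3.
  by rewrite prednK.
- by move=> i /cases[->|->|[_ _ _ ? _]] //; rewrite e2 e1.
- exact: splits_off_Z_cup_isolated.
- by rewrite e1; apply: splits_off_Z_cup_isolated.
- exists z; split; first exact/commgP/eqP.
  by move=> /commgP/eqP.
Qed.

Theorem lemma5p2 (Gamma : sgraph) (m : nat) (p : nat -> raag Gamma) :
  is_path_graph Gamma -> (1 < #|Gamma|)%N -> (3 <= m)%N ->
  (forall i : nat, (1 <= i <= m)%N -> pearl (p i)) ->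
  condE (p 1%N) (p 2%N) (p 3%N) ->
  condE (p m) (p (m - 1)%N) (p (m - 2)%N) ->
  (forall i : nat, (3 <= i <= m - 2)%N ->
     condT (p (i - 1)%N) (p i) (p (i + 1)%N)) ->
  vertex_basis [set p i | i in [set i : nat | (1 <= i <= m)%N]].
Proof.
move=> path n1 m2 _ E1 E2 T; have [vx0 [ix0 co0]] := path_graph_coordinates path (ltnW n1).
have qc := pearl_chain_of_conditions m2 E1 E2 T.
have [vx [ix [co q1]]] : exists vx ix, path_coordinates #|Gamma| vx ix /\
    conj_pm (raag_gen (vx 1%N)) (p 2%N).
  have [|i [i0 i_n qi]] := path_inner_pearl co0 (x := p 2%N).
    by apply: (chain_inner qc (i := 1%N)); lia.
  have [i1|i2] := path_cup_isolated co0 i0 i_n qi (chain_cup qc).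
    by exists vx0, ix0; rewrite i1 in qi.
  (* Here p_2 lies next to the last vertex, so the path is read backwards to bring it to position
     1. *)
  exists (fun i => vx0 (#|Gamma|.-1 - i)%N), (fun u => (#|Gamma|.-1 - ix0 u)%N).
  split; first exact: path_coordinates_rev.
  by rewrite (_ : _ - 1 = i)%N //; lia.
have [mn [phi [psi [[phiK psiK] qE]]]] := chain_basis co qc m2 q1.
exists phi; split; first by exists psi.
apply/seteqP; split=> [_ [i /= im <-]|_ [_ [u _ <-] <-]].
  case: i im => [//|i im]; exists (raag_gen (vx i)); first by exists (vx i).
  by rewrite qE // -mn.
exists (ix u).+1; first by rewrite /= mn (ix_lt co).
by rewrite qE ?(ix_lt co) // (ixK co).
Qed.
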